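(* Let $0<p<1$. (a) Let $F\in H_p(G)$ and let $\{m_k:k\ge0\}$ be a sequence of positive integers such that $$\omega_{H_p}\!\left(\frac1{2^{|m_k|}},F\right)=o\!\left(\frac1{\bigl(m_k\,\mu(\operatorname{supp}D_{m_k})\bigr)^{1/p-1}}\right)\quad\text{as }k\to\infty .$$ Then $\|S_{m_k}F-F\|_{H_p}\to0$ as $k\to\infty$. (b) There is a constant $c_p>0$, depending only on $p$, such that the following holds. Let $\{m_k:k\ge0\}$ be any increasing sequence of positive integers with $\sup_{k\in\mathbb{N}}m_k\,\mu(\operatorname{supp}D_{m_k})=\infty$. Then there exist a martingale $F\in H_p(G)$ and a subsequence $\{\alpha_k:k\ge0\}\subset\{m_k:k\ge0\}$ for which $$\omega_{H_p}\!\left(\frac1{2^{|\alpha_k|}},F\right)=O\!\left(\frac1{\bigl(\alpha_k\,\mu(\operatorname{supp}D_{\alpha_k})\bigr)^{1/p-1}}\right)\quad\text{as }k\to\infty$$ and $$\limsup_{k\to\infty}\|S_{\alpha_k}F-F\|_{L_{p,\infty}}>c_p>0 .$$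
   Context: $\mathbb{N}_+$ is the set of positive integers and $\mathbb{N}=\mathbb{N}_+\cup\{0\}$. $G=\prod_{k=0}^\infty Z_2$ is the dyadic (Walsh) group, i.e. the set of sequences $x=(x_0,x_1,\dots)$, $x_k\in\{0,1\}$, with coordinatewise addition mod 2, product topology, and normalized Haar measure $\mu$ (the product of the measures giving mass $1/2$ to each point of $Z_2$). Put $I_0(x)=G$, $I_n(x)=\{y\in G: y_0=x_0,\dots,y_{n-1}=x_{n-1}\}$, and let $\zeta_n$ be the $\sigma$-algebra generated by $\{I_n(x):x\in G\}$. For $n\in\mathbb{N}_+$ with binary expansion $n=\sum_{j\ge0}n_j2^j$, $n_j\in\{0,1\}$, put $|n|=\max\{j:n_j\neq0\}$. Rademacher functions: $r_k(x)=(-1)^{x_k}$. Walsh functions: $w_n(x)=\prod_{k\ge0}r_k(x)^{n_k}$, $n\in\mathbb{N}$. Dirichlet kernels: $D_n=\sum_{k=0}^{n-1}w_k$ for $n\in\mathbb{N}_+$; $\operatorname{supp}D_n=\{x\in G:D_n(x)\ne0\}$ (this set is clopen, as $D_n$ is locally constant). A martingale $F=(F_n,n\in\mathbb{N})$ is a martingale with respect to $(\zeta_n)_{n\in\mathbb N}$. Its maximal function is $F^*=\sup_n|F_n|$; for $0<p<\infty$, $H_p(G)$ is the space of martingales with $\|F\|_{H_p}:=\|F^*\|_p<\infty$, where $\|f\|_p^p=\int_G|f|^p\,d\mu$. Walsh–Fourier coefficients of a martingale: $\widehat F(k)=\lim_{n\to\infty}\int_GF_nw_k\,d\mu$ (the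 limit always exists). Partial sums: $S_nF=\sum_{k=0}^{n-1}\widehat F(k)w_k$; in particular $S_{2^n}F=F_n$. An integrable function $f$ (such as $S_nF$) is identified with the martingale $(E(f\mid\zeta_n))_{n}$ of its conditional expectations, so that $S_nF-F$ is a martingale. The modulus of continuity in $H_p(G)$, $0<p\le1$, is $\omega_{H_p}(1/2^n,F):=\|F-S_{2^n}F\|_{H_p}$. The weak quasi-norm is $\|f\|_{L_{p,\infty}}^p=\sup_{\lambda>0}\lambda^p\mu(|f|>\lambda)$. For a martingale in $H_p(G)$ (such as $S_nF-F$ with $F\in H_p(G)$), which converges a.e., the weak quasi-norm is taken of its a.e. limit function. *)

(* Defs.v *)
From HB Require Import structures.
From mathcomp Require Import all_boot all_order all_algebra.
From mathcomp Require Import all_classical all_reals all_analysis.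
From mathcomp Require Import ring lra.

Set Implicit Arguments.
Unset Strict Implicit.
Unset Printing Implicit Defensive.

Import Order.TTheory GRing.Theory Num.Theory.
Import numFieldNormedType.Exports.

Local Open Scope classical_set_scope.
Local Open Scope ring_scope.

(* [bool] with [addb] is Z_2; [cantor_space] carries the product topology, and
   the measurable structure of [dyadic_group] is its Borel sigma-algebra. *)
Definition dyadic_group : Type := g_sigma_algebraType (@open cantor_space).

HB.instance Definition _ := Measurable.on dyadic_group.

Definition dadd (x y : dyadic_group) : dyadic_group := fun k => x k (+) y k.

Definition haar (R : realType) (mu : probability dyadic_group R) : Prop :=
  forall (a : dyadic_group) (A : set dyadic_group),
    measurable A -> mu (dadd a @` A) = mu A.

Definition cyl (n : nat) (x : dyadic_group) : set dyadic_group :=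
  [set y | forall k, (k < n)%N -> y k = x k].

Definition zeta (n : nat) : set (set dyadic_group) := <<s range (cyl n) >>.

Definition zeta_measurable (R : realType) (n : nat) (f : dyadic_group -> R) :
  Prop := forall B : set R, measurable B -> zeta n (f @^-1` B).

Definition binary_digit (n j : nat) : bool := odd (n %/ 2 ^ j).

(* The digits of [n] of index [j >= n] vanish, so that [j < n] suffices here
   and in [walsh]. *)
Definition binary_order (n : nat) : nat := \max_(j < n | binary_digit n j) j.

Definition rademacher (R : realType) (k : nat) (x : dyadic_group) : R :=
  (-1) ^+ x k.

Definition walsh (R : realType) (n : nat) (x : dyadic_group) : R :=
  \prod_(k < n) rademacher R k x ^+ binary_digit n k.

Definition dirichlet (R : realType) (n : nat) (x : dyadic_group) : R :=
  \sum_(k < n) walsh R k x.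

Definition supp_dirichlet (R : realType) (n : nat) : set dyadic_group :=
  [set x | dirichlet R n x != 0].

Section dyadic_martingales.
Context (R : realType) (mu : probability dyadic_group R).
Implicit Types (f g : dyadic_group -> R) (F : nat -> dyadic_group -> R) (p : R).

Definition is_cond_exp (n : nat) f g : Prop :=
  [/\ zeta_measurable n g,
      mu.-integrable [set: dyadic_group] (EFin \o g) &
      forall A, zeta n A -> \int[mu]_(x in A) g x = \int[mu]_(x in A) f x].

(* For Haar measure the atoms [cyl n x] have positive mass, hence there is
   exactly one version of E(f | zeta_n), see [cond_expE] below. *)
Definition cond_exp (n : nat) f : dyadic_group -> R :=
  xget (fun=> 0) [set g | is_cond_exp n f g].

Definition dyadic_martingale F : Prop :=
  [/\ forall n, zeta_measurable n (F n),
      forall n, mu.-integrable [set: dyadic_group] (EFin \o F n) &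
      forall n m, (n <= m)%N -> cond_exp n (F m) = F n].

Definition maximal_function F (x : dyadic_group) : \bar R :=
  ereal_sup (range (fun n => `|F n x|%:E)).

Definition Hp_norm p F : \bar R := Lnorm mu p%:E (maximal_function F).

Definition Hp p F : Prop := dyadic_martingale F /\ (Hp_norm p F < +oo)%E.

Definition fourier_coef F (k : nat) : R :=
  lim ((\int[mu]_x (F n x * walsh R k x)) @[n --> \oo]).

Definition partial_sum (n : nat) F (x : dyadic_group) : R :=
  \sum_(k < n) fourier_coef F k * walsh R k x.

Definition martingale_of f : nat -> dyadic_group -> R := fun n => cond_exp n f.

(* The martingale S_n F - F. *)
Definition partial_sum_error (n : nat) F : nat -> dyadic_group -> R :=
  fun j x => martingale_of (partial_sum n F) j x - F j x.

(* [Hp_modulus p n F] is the modulus of continuity of F at 1 / 2^n. *)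
Definition Hp_modulus p (n : nat) F : \bar R :=
  Hp_norm p (fun j x => F j x - martingale_of (partial_sum (2 ^ n) F) j x).

(* Only meant for martingales that converge almost everywhere: elsewhere [lim]
   is a default value. *)
Definition limit_function F (x : dyadic_group) : R := lim (F n x @[n --> \oo]).

Definition weak_Lp_norm p f : \bar R :=
  poweR (ereal_sup [set ((l `^ p)%:E * mu [set x | l < `|f x|]%R)%E
                   | l in [set l : R | 0 < l]]) p^-1.

(* The rate (m mu(supp D_m))^(1/p - 1). *)
Definition supp_rate p (m : nat) : R :=
  (m%:R * fine (mu (supp_dirichlet R m))) `^ (p^-1 - 1).

End dyadic_martingales.

(* Landau symbols for a sequence of extended reals compared with a sequence of
   reals. *)
Definition ereal_littleo (R : realType) (u : nat -> \bar R) (v : nat -> R) :=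
  forall e : R, 0 < e -> \forall k \near \oo, (`|u k| <= (e * `|v k|)%:E)%E.

Definition ereal_bigO (R : realType) (u : nat -> \bar R) (v : nat -> R) :=
  exists C : R, \forall k \near \oo, (`|u k| <= (C * `|v k|)%:E)%E.

Lemma cyl_refl n x : cyl n x x.
Proof. by []. Qed.

Lemma cyl_eq n x y : cyl n x y -> cyl n y = cyl n x.
Proof.
move=> xy; apply/seteqP; split=> z /= h k kn; first by rewrite h// xy.
by rewrite h// -xy.
Qed.

Lemma cyl0 x : cyl 0 x = setT.
Proof. by apply/seteqP; split. Qed.

Lemma measurable_coord k (b : bool) : measurable [set y : dyadic_group | y k = b].
Proof.
apply: sub_sigma_algebra.
have -> : [set y : dyadic_group | y k = b] = proj k @^-1` [set b] by [].
apply: (@open_comp cantor_space bool) => [? _|]; last exact: discrete_open.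
exact: (@proj_continuous _ (fun=> bool)).
Qed.

Lemma measurable_cyl n x : measurable (cyl n x).
Proof.
have -> : cyl n x = \bigcap_(k in [set k | (k < n)%N]) [set y | y k = x k].
  by apply/seteqP; split=> y h k kn; exact: h.
by apply: bigcap_measurableType => k _; exact: measurable_coord.
Qed.

Lemma open_cyl (U : set cantor_space) x : open U -> U x ->
  exists n, cyl n x `<=` U.
Proof.
move=> oU Ux; apply: contrapT => /forallNP noU.
have /choice[y yP] : forall n, exists y, cyl n x y /\ ~ U y.
  by move=> n; have /existsNP[y /not_implyP[]] := noU n; exists y.
have yx : (y : nat -> cantor_space) n @[n --> \oo] --> (x : cantor_space).
  apply/cvg_sup => i A [_ [[C oC <-] Cx] CA]; exists i.+1 => // n /= ni.
  by apply: CA; rewrite /= (yP n).1.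
have : nbhs (x : cantor_space) U by exact: open_nbhs_nbhs.
by move=> /yx [N _ /(_ N (leqnn N))]; exact: (yP N).2.
Qed.

Definition cylinders : set (set dyadic_group) :=
  [set A | A = set0 \/ exists n x, A = cyl n x].

Lemma cylinders_setI : setI_closed cylinders.
Proof.
move=> A B [->|[n [x ->]]]; first by rewrite set0I; left.
move=> [->|[m [y ->]]]; first by rewrite setI0; left.
have [[z [xz yz]]|nz] := pselect (exists z, cyl n x z /\ cyl m y z); last first.
  by left; rewrite -subset0 => z [xz yz]; apply: nz; exists z.
rewrite -(cyl_eq xz) -(cyl_eq yz); right; exists (maxn n m), z.
apply/seteqP; split=> [t [h1 h2] k|t h].
  by rewrite leq_max => /orP[/h1|/h2].
by split=> k kn; apply: h; rewrite leq_max kn ?orbT.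
Qed.

Lemma measurable_cylinders :
  (measurable : set (set dyadic_group)) = <<s cylinders >>.
Proof.
apply/seteqP; split; last first.
  apply: smallest_sub; first exact: sigma_algebra_measurable.
  by move=> A [->|[n [x ->]]]; [exact: measurable0|exact: measurable_cyl].
apply: smallest_sub; first exact: smallest_sigma_algebra.
move=> U oU.
have -> : U = \bigcup_(s : seq bool)
    (if `[< cyl (size s) (nth false s) `<=` U >] then cyl (size s) (nth false s)
     else set0).
  apply/seteqP; split=> [x Ux|x [s _]]; last by case: asboolP => [sU /sU|_ []].
  have [n nU] := open_cyl oU Ux; exists (mkseq x n) => //.
  have e : cyl (size (mkseq x n)) (nth false (mkseq x n)) = cyl n x.
    rewrite size_mkseq; apply: cyl_eq => k kn.
    by rewrite nth_mkseq.
  by rewrite e; case: asboolP.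
apply: (@countable_bigcupT_measurable _ (g_sigma_algebraType cylinders)) => //.
move=> s; case: asboolP => _; last exact: measurable0.
by apply: sub_sigma_algebra; right; exists (size s), (nth false s).
Qed.

Lemma cyl_measure_unique (R : realType)
    (mu nu : {measure set dyadic_group -> \bar R}) :
  (mu setT < +oo)%E -> (forall n x, mu (cyl n x) = nu (cyl n x)) ->
  forall A, measurable A -> mu A = nu A.
Proof.
move=> muT munu; apply: (measure_unique cylinders (fun=> setT)).
- exact: measurable_cylinders.
- exact: cylinders_setI.
- by move=> _; right; exists 0%N, (fun=> false); rewrite cyl0.
- by rewrite bigcup_const.
- by move=> A [->|[n [x ->]]]; [rewrite !measure0|exact: munu].
- by [].
Qed.

Lemma daddK a : involutive (dadd a).
Proof. by move=> x; apply/funext => k; rewrite /dadd addbA addbb addFb. Qed.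

Lemma image_dadd a A : dadd a @` A = dadd a @^-1` A.
Proof.
apply/seteqP; split=> [_ [x Ax <-] /=|x /= Ax]; first by rewrite daddK.
by exists (dadd a x) => //; rewrite daddK.
Qed.

Lemma preimage_dadd_cyl a n x : dadd a @^-1` cyl n x = cyl n (dadd a x).
Proof.
apply/seteqP; split=> y /= h k /h; rewrite /dadd.
  by move=> <-; rewrite addbA addbb addFb.
by move=> ->; rewrite addbA addbb addFb.
Qed.

Definition dflip (n : nat) : dyadic_group -> dyadic_group :=
  dadd (fun k => k == n).

Lemma cylS n x : cyl n x = cyl n.+1 x `|` cyl n.+1 (dflip n x).
Proof.
apply/seteqP; split => y; last first.
  by case=> h k kn; rewrite (h k (ltnW kn)) // /dflip /dadd (ltn_eqF kn).
move=> h; have [yx|yx] := eqVneq (y n) (x n).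
  by left=> k; rewrite ltnS leq_eqVlt => /predU1P[->//|kn]; exact: h.
right=> k; rewrite ltnS leq_eqVlt => /predU1P[->|kn].
  by rewrite /dflip /dadd eqxx; case: (y n) (x n) yx => -[].
by rewrite /dflip /dadd (ltn_eqF kn) h.
Qed.

Lemma cylS_disjoint n x : cyl n.+1 x `&` cyl n.+1 (dflip n x) = set0.
Proof.
rewrite -subset0 => y [] /(_ n (ltnSn n)) h1 /(_ n (ltnSn n)).
by rewrite h1 /dflip /dadd eqxx; case: (x n).
Qed.

Lemma measurable_dadd a : measurable_fun setT (dadd a).
Proof.
apply: (measurability cylinders); first exact: measurable_cylinders.
move=> _ [A [->|[n [x ->]]] <-]; rewrite setTI ?preimage_set0//.
by rewrite preimage_dadd_cyl; exact: measurable_cyl.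
Qed.

Lemma haar_cyl (R : realType) (mu : probability dyadic_group R) :
  haar mu <-> forall n x, mu (cyl n x) = ((2 ^+ n)^-1)%:E.
Proof.
split=> [hmu|hmu a A mA]; last first.
  rewrite image_dadd.
  apply/esym; apply: (@cyl_measure_unique _ mu (pushforward mu (dadd a))) => //.
  - exact: measurable_dadd.
  - by apply: (@le_lt_trans _ _ 1%E); [exact: probability_le1|exact: ltry].
  - by move=> mda n x; apply: etrans (hmu n x) _; apply/esym;
    have := hmu n (dadd a x); rewrite -preimage_dadd_cyl; apply.
elim=> [|n IHn] x; first by rewrite cyl0 expr0 invr1; exact: probability_setT.
have -> : mu (cyl n.+1 x) = (2^-1%:E * mu (cyl n x))%E; last first.
  by rewrite IHn -EFinM exprS invfM.
have hU : mu (cyl n x) = (mu (cyl n.+1 x) + mu (cyl n.+1 x))%E.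
  apply: etrans (congr1 mu (cylS n x)) _.
  apply: etrans (measureU mu _ _ (cylS_disjoint n x)) _.
  - exact: measurable_cyl.
  - exact: measurable_cyl.
  - congr (_ + _)%E; rewrite -preimage_dadd_cyl -image_dadd; apply: hmu.
    exact: measurable_cyl.
have : mu (cyl n.+1 x) \is a fin_num.
  by apply: fin_num_measure; exact: measurable_cyl.
rewrite hU => /fineK <-; rewrite -EFinD -EFinM; congr EFin; lra.
Qed.

Lemma haar_unique (R : realType) (mu nu : probability dyadic_group R) :
  haar mu -> haar nu -> forall A, measurable A -> mu A = nu A.
Proof.
move=> /haar_cyl hmu /haar_cyl hnu A mA.
apply: (@cyl_measure_unique _ mu nu) => // [|n x].
  by apply: (@le_lt_trans _ _ 1%E); [exact: probability_le1|exact: ltry].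
exact: etrans (hmu n x) (esym (hnu n x)).
Qed.

(* Haar measure is the image of Lebesgue measure on [0, 1[ under binary
   expansion. *)
Section haar_existence.
Context (R : realType).

Let digits (t : R) : dyadic_group :=
  fun k => (0 <= t < 1) && odd (Num.truncn (2 ^+ k.+1 * t)).

Let prefix (x : dyadic_group) := fix prefix n : nat :=
  if n is n'.+1 then ((prefix n').*2 + x n')%N else 0%N.

Let truncn_double (s : R) : 0 <= s ->
  (Num.truncn (2 * s) = (Num.truncn s).*2 + odd (Num.truncn (2 * s)))%N.
Proof.
move=> s0; have s20 : 0 <= 2 * s by lra.
have /andP[] := truncn_itv s0; have /andP[] := truncn_itv s20.
set a := Num.truncn (2 * s); set b := Num.truncn s => h1 h2 h3 h4.
have ab : (b.*2 <= a)%N.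
  rewrite -ltnS -(ltr_nat R); apply: le_lt_trans h2.
  by rewrite -mul2n natrM; lra.
have ba : (a < b.*2.+2)%N.
  rewrite -(ltr_nat R); apply: le_lt_trans h1 _.
  by rewrite -doubleS -mul2n natrM; lra.
have : a = b.*2 \/ a = b.*2.+1.
  by move: ba ab; rewrite ltnS leq_eqVlt ltnS => /predU1P[->|ba ab];
    [right | left; apply/eqP; rewrite eqn_leq ba].
by case=> ->; rewrite /= odd_double ?addn0 ?addn1.
Qed.

Let digits_cyl n x t : 0 <= t < 1 ->
  cyl n x (digits t) <-> Num.truncn (2 ^+ n * t) = prefix x n.
Proof.
move=> t01; have /andP[t0 t1] := t01.
elim: n => [|n [IH1 IH2]].
  split=> // _; rewrite expr0 mul1r; apply/eqP.
  by rewrite truncn_eq// t0.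
have dbl := truncn_double (mulr_ge0 (exprn_ge0 n (ler0n R 2)) t0).
rewrite mulrA -exprS in dbl.
split=> [h|h k].
  rewrite dbl IH1; last by move=> k kn; apply: h; exact: ltnW.
  by rewrite /= -(h n (ltnSn n)) /digits t01.
have xn : digits t n = x n.
  by rewrite /digits t01 h /= oddD odd_double; case: (x n).
rewrite ltnS leq_eqVlt => /predU1P[->//|]; apply: IH2.
move: h; rewrite dbl /= => /eqP; rewrite -xn /digits t01 /=.
by rewrite eqn_add2r => /eqP /double_inj.
Qed.

Let digits_preimage n x : digits @^-1` cyl n x `&` `[0, 1[ =
  `[(prefix x n)%:R / 2 ^+ n, (prefix x n).+1%:R / 2 ^+ n[%classic.
Proof.
have p2 : 0 < 2 ^+ n :> R by rewrite exprn_gt0.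
have pre : ((prefix x n).+1 <= 2 ^ n)%N.
  elim: n {p2} => //= n IH; rewrite expnS mul2n.
  apply: leq_trans (_ : ((prefix x n).+1).*2 <= _)%N; last by rewrite leq_double.
  by rewrite doubleS !ltnS -addn1 leq_add2l leq_b1.
apply/seteqP; split=> [t /= [h]|t /=]; rewrite !in_itv /= => tI.
  have /andP[t0 _] := tI.
  have /eqP := (digits_cyl n x tI).1 h.
  rewrite (truncn_eq _ (mulr_ge0 (ltW p2) t0)).
  by rewrite ler_pdivrMr// ltr_pdivlMr// (mulrC t).
have t01 : 0 <= t < 1.
  have /andP[a b] := tI; rewrite (le_trans _ a) /=; last first.
    by rewrite divr_ge0// exprn_ge0.
  apply: lt_le_trans b _; rewrite ler_pdivrMr// mul1r -natrX ler_nat //.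
split=> //; apply/digits_cyl => //; apply/eqP; have /andP[t0 _] := t01.
rewrite (truncn_eq _ (mulr_ge0 (ltW p2) t0)).
by rewrite mulrC -ler_pdivrMr// -ltr_pdivlMr.
Qed.

Let measurable01 : measurable (`[0, 1[%classic : set R).
Proof. exact: measurable_itv. Qed.

Let measurable_digits : measurable_fun [set: measurableTypeR R] digits.
Proof.
apply: (measurability cylinders); first exact: measurable_cylinders.
move=> _ [A [->|[n [x ->]]] <-]; rewrite setTI ?preimage_set0//.
have -> : digits @^-1` cyl n x = (digits @^-1` cyl n x `&` `[0, 1[) `|`
    (if `[< cyl n x (fun=> false) >] then ~` `[0, 1[ else set0).
  apply/seteqP; split=> t /=; rewrite in_itv /=.
    have [t01 h|t01 h] := boolP (0 <= t < 1); first by left.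
    right; case: asboolP => [_ //=|]; first by rewrite in_itv /=; exact/negP.
    by apply => k kn; rewrite -h // /digits (negbTE t01).
  case=> [[]//|]; case: asboolP => // h /=; rewrite in_itv /= => /negP t01 k kn.
  by rewrite -h // /digits (negbTE t01).
apply: measurableU; first by rewrite digits_preimage; exact: measurable_itv.
by case: asboolP => _; [exact: measurableC|exact: measurable0].
Qed.

Definition haar_measure : set dyadic_group -> \bar R :=
  pushforward (mrestr (@lebesgue_measure R) measurable01) digits.

Let haar_measure0 : haar_measure set0 = 0%E.
Proof. by rewrite /haar_measure /pushforward preimage_set0 measure0. Qed.

Let haar_measure_ge0 A : (0 <= haar_measure A)%E.
Proof.
exact: measure_ge0.
Qed.

Let haar_measure_sigma_additive : semi_sigma_additive haar_measure.
Proof.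
move=> F mF tF mUF; rewrite /haar_measure /pushforward preimage_bigcup.
apply: measure_semi_sigma_additive.
- by move=> n; rewrite -[X in measurable X]setTI; exact: measurable_digits.
- apply/trivIsetP => /= i j _ _ ij; rewrite -preimage_setI.
  by move/trivIsetP : tF => /(_ _ _ _ _ ij) ->//; rewrite preimage_set0.
- by rewrite -preimage_bigcup -[X in measurable X]setTI; exact: measurable_digits.
Qed.

HB.instance Definition _ := isMeasure.Build _ dyadic_group R haar_measure
  haar_measure0 haar_measure_ge0 haar_measure_sigma_additive.

Let haar_measure_cyl n x : haar_measure (cyl n x) = ((2 ^+ n)^-1)%:E.
Proof.
rewrite /haar_measure /pushforward /mrestr digits_preimage lebesgue_measure_itv.
rewrite /= lte_fin ltr_pM2r ?invr_gt0 ?exprn_gt0// ltr_nat ltnSn -EFinB.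
by rewrite -mulrBl -natrB ?subSnn ?mul1r.
Qed.

Let haar_measureT : haar_measure setT = 1%E.
Proof. by rewrite -(cyl0 (fun=> false)) haar_measure_cyl expr0 invr1. Qed.

HB.instance Definition _ := Measure_isProbability.Build _ dyadic_group R
  haar_measure haar_measureT.

Lemma haar_exists : exists mu : probability dyadic_group R, haar mu.
Proof. by exists haar_measure; apply/haar_cyl => n x; exact: haar_measure_cyl. Qed.

End haar_existence.

Lemma zetaP n (A : set dyadic_group) :
  zeta n A <-> forall x, A x -> cyl n x `<=` A.
Proof.
split=> [|hA].
  move: A; apply: smallest_sub; last first.
    by move=> _ [y _ <-] x /cyl_eq ->.
  split=> [x []|A hA x [_ nAx]|F hF x [k _ Fx]].
  - move=> y yx; split=> // Ay; apply: nAx; apply: (hA _ Ay).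
    by rewrite (cyl_eq yx); exact: cyl_refl.
  - by move=> y yx; exists k => //; exact: (hF _ _ Fx).
have -> : A = \bigcup_(s : seq bool)
    (if `[< cyl n (nth false s) `<=` A >] then cyl n (nth false s) else set0).
  apply/seteqP; split=> [x Ax|x [s _]]; last first.
    by case: asboolP => [sA /sA|_ []].
  exists (mkseq x n) => //.
  have e : cyl n (nth false (mkseq x n)) = cyl n x.
    by apply: cyl_eq => k kn; rewrite nth_mkseq.
  by rewrite e; case: asboolP => // /(_ (hA x Ax)).
apply: (@countable_bigcupT_measurable _ (g_sigma_algebraType (range (cyl n)))) => //.
move=> s; case: asboolP => _; last exact: measurable0.
by apply: sub_sigma_algebra; exists (nth false s).
Qed.

Lemma zeta_sub_measurable n : zeta n `<=` measurable.
Proof.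
apply: smallest_sub; first exact: sigma_algebra_measurable.
by move=> _ [x _ <-]; exact: measurable_cyl.
Qed.

Lemma zeta_measurable_const (R : realType) n (g : dyadic_group -> R) x y :
  zeta_measurable n g -> cyl n x y -> g y = g x.
Proof. by move=> /(_ [set g x] (measurable_set1 _))/zetaP /(_ x erefl) /[apply]. Qed.

Section cond_exp_theory.
Context (R : realType) (mu : probability dyadic_group R) (mu_haar : haar mu).
Implicit Types f g : dyadic_group -> R.

Let mu_cyl n x : mu (cyl n x) = ((2 ^+ n)^-1)%:E.
Proof. by move/haar_cyl : mu_haar; exact. Qed.

Lemma Rintegral_cyl n x g : zeta_measurable n g ->
  \int[mu]_(y in cyl n x) g y = g x / 2 ^+ n.
Proof.
move=> mg; rewrite (@eq_Rintegral _ _ _ mu _ (fun=> g x)); last first.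
  by move=> y /set_mem; exact: zeta_measurable_const.
rewrite Rintegral_cst; last exact: measurable_cyl.
by rewrite [X in fine X]mu_cyl.
Qed.

Let average n f x : R := 2 ^+ n * \int[mu]_(y in cyl n x) f y.

Let average_zeta n f : zeta_measurable n (average n f).
Proof.
by move=> B _; apply/zetaP => x /= Bx y xy /=; rewrite /average (cyl_eq xy).
Qed.

Let average_integrable n f : mu.-integrable [set: dyadic_group] (EFin \o f) ->
  mu.-integrable [set: dyadic_group] (EFin \o average n f).
Proof.
move=> intf; apply: measurable_bounded_integrable => //.
- by apply: (@le_lt_trans _ _ 1%E); [exact: probability_le1|exact: ltry].
- by move=> _ B mB; rewrite setTI; apply: (@zeta_sub_measurable n); exact: average_zeta.
- exists (2 ^+ n * \int[mu]_y `|f y|); split=> [|M hM x _ /=]; first exact: num_real.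
  apply: le_trans (ltW hM).
  rewrite /average normrM ger0_norm ?exprn_ge0// ler_wpM2l ?exprn_ge0//.
  apply: le_trans (le_normr_Rintegral _ _ ) _.
  - exact: measurable_cyl.
  - by apply: integrableS intf => //; exact: measurable_cyl.
  have intnf := integrable_norm intf.
  have mc : measurable (cyl n x) by exact: measurable_cyl.
  have sc : cyl n x `<=` [set: dyadic_group] by [].
  apply: fine_le; [| |apply: ge0_subset_integral => //].
  - by apply: integrable_fin_num => //; exact: integrableS intnf.
  - exact: integrable_fin_num.
  - by case/integrableP : intnf.
Qed.

Lemma is_cond_exp_average n f : mu.-integrable [set: dyadic_group] (EFin \o f) ->
  is_cond_exp mu n f (average n f).
Proof.
move=> intf; split; [exact: average_zeta|exact: average_integrable|].
move=> A /[dup] /zeta_sub_measurable mA /zetaP hA.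
have H m x : (m <= n)%N -> \int[mu]_(y in A `&` cyl m x) average n f y =
    \int[mu]_(y in A `&` cyl m x) f y.
  move=> mn; rewrite -(subKn mn); move: (n - m)%N (leq_subr m n) x => {m mn}.
  elim=> [_ x|k IH kn x].
    rewrite subn0; have [[z [Az xz]]|nz] := pselect (exists z, A z /\ cyl n x z).
      rewrite -(cyl_eq xz) (setIidr (hA z Az)) Rintegral_cyl// /average.
      by rewrite mulrAC divff ?mul1r// expf_neq0// pnatr_eq0.
    have -> : A `&` cyl n x = set0; last by rewrite !Rintegral_set0.
    by rewrite -subset0 => z [Az xz]; apply: nz; exists z.
  have IHk := IH (ltnW kn).
  have e : (n - k = (n - k.+1).+1)%N by rewrite subnSK.
  rewrite cylS setIUr.
  have mAc m y : measurable (A `&` cyl m y).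
    by apply: measurableI => //; exact: measurable_cyl.
  have dis : [disjoint A `&` cyl (n - k.+1).+1 x &
      A `&` cyl (n - k.+1).+1 (dflip (n - k.+1) x)].
    by apply/disj_setPS; rewrite setIACA cylS_disjoint setI0.
  have int g : mu.-integrable [set: dyadic_group] (EFin \o g) ->
     mu.-integrable (A `&` cyl (n - k.+1).+1 x `|`
        A `&` cyl (n - k.+1).+1 (dflip (n - k.+1) x)) (EFin \o g).
    by apply: integrableS => //; exact: measurableU.
  rewrite !Rintegral_setU//; try exact: int.
    by rewrite -e !IHk.
  by apply: int; exact: average_integrable.
by have := H 0%N (fun=> false) (leq0n n); rewrite cyl0 setIT.
Qed.

Lemma is_cond_exp_unique n f g h :
  is_cond_exp mu n f g -> is_cond_exp mu n f h -> g = h.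
Proof.
move=> [mg _ gf] [mh _ hf]; apply/funext => x.
have zx : zeta n (cyl n x) by apply/zetaP => y xy; rewrite (cyl_eq xy).
have := etrans (gf _ zx) (esym (hf _ zx)); rewrite !Rintegral_cyl//.
by apply: mulIf; rewrite invr_neq0// expf_neq0// pnatr_eq0.
Qed.

Lemma cond_expP n f : mu.-integrable [set: dyadic_group] (EFin \o f) ->
  is_cond_exp mu n f (cond_exp mu n f).
Proof.
by move=> /(is_cond_exp_average n); exact: (@xgetI _ (fun=> 0) [set g | is_cond_exp mu n f g]).
Qed.

Lemma cond_expE n f x : mu.-integrable [set: dyadic_group] (EFin \o f) ->
  cond_exp mu n f x = 2 ^+ n * \int[mu]_(y in cyl n x) f y.
Proof.
move=> intf; have := is_cond_exp_unique (cond_expP n intf) (is_cond_exp_average n intf).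
by move=> ->.
Qed.

End cond_exp_theory.

(* Main.v *)
Require Import Defs.
From mathcomp Require Import all_boot all_order all_algebra.
From mathcomp Require Import all_classical all_reals all_analysis.
From mathcomp Require Import measurable_realfun.
From mathcomp Require Import zify ring lra.

(* Let l be the index of the lowest binary digit of m and N = |m| that of the
   highest.  The support of D_m is the cylinder of length l at 0, so that
   m mu(supp D_m) is comparable with 2^(N - l).

   (a) S_m F - F = P - (F - S_(2^N) F), where P is the Walsh section of order
   [2^N, m) of d = F_(N+1) - F_N.  As a martingale, P vanishes up to time N and
   is constant afterwards, hence its H_p norm is its L_p norm; moreover |d| is
   dominated by the maximal function of F - S_(2^N) F.  Since the kernel
   D_m - D_(2^N) is bounded by the sum of 2^j 1_(I_j) over l <= j < N, and
   since (\sum a_i)^p <= \sum a_i^p, the L_p norm of P is at most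
   c 2^((N - l)(1/p - 1)) times that of d.

   (b) Along a subsequence with N_k - l_k growing fast enough, F is the sum of
   the b_k (D_(2^(N_k + 1)) - D_(2^(N_k))) with b_k = 2^(l_k (1/p - 1)).  Every
   Fourier coefficient of F of index in [2^N_k, 2^(N_k + 1)) is b_k, so that on
   I_l minus I_(l+1), l = l_k, where all the terms of F of rank at least k
   vanish, the error is b_k D_(alpha_k), of modulus 2^(l/p); and this set has
   measure 2^(-l-1). *)

Set Implicit Arguments.
Unset Strict Implicit.
Unset Printing Implicit Defensive.

Import Order.TTheory GRing.Theory Num.Theory.
Import numFieldNormedType.Exports.

Local Open Scope classical_set_scope.
Local Open Scope ring_scope.

(** * Walsh functions and Dirichlet kernels *)

Definition dzero : dyadic_group := fun=> false.

(** Shifting the digits of [x] goes with halving the index of a Walsh function; the inductions on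
    binary expansions rest on this pair. *)
Definition dshift (x : dyadic_group) : dyadic_group := fun k => x k.+1.

Lemma mem_cyl0 n x : (x \in cyl n dzero) <-> forall k, (k < n)%N -> x k = false.
Proof. by rewrite in_setE. Qed.

Lemma mem_cyl0S n x :
  (x \in cyl n.+1 dzero) = ~~ x 0%N && (dshift x \in cyl n dzero).
Proof.
apply/idP/andP => [/mem_cyl0 h|[/negbTE x0 /mem_cyl0 h]].
  by split; [rewrite h|apply/mem_cyl0 => k kn; rewrite /dshift h].
by apply/mem_cyl0 => -[|k] kn //; exact: h.
Qed.

(** * Binary digits *)

Lemma binary_digit_small n j : (n < 2 ^ j)%N -> binary_digit n j = false.
Proof. by move=> nj; rewrite /binary_digit divn_small. Qed.

Lemma binary_digitS n j : binary_digit n j.+1 = binary_digit n./2 j.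
Proof. by rewrite /binary_digit expnS divnMA divn2. Qed.

Lemma binary_digit_top n N : (2 ^ N <= n < 2 ^ N.+1)%N -> binary_digit n N.
Proof.
move=> /andP[h1 h2]; rewrite /binary_digit.
suff -> : (n %/ 2 ^ N = 1)%N by [].
apply/eqP; rewrite eqn_leq leq_divRL ?expn_gt0// mul1n h1 andbT -ltnS.
by rewrite ltn_divLR ?expn_gt0// -expnS.
Qed.

Lemma binary_order_bounds n : (0 < n)%N ->
  (2 ^ binary_order n <= n < 2 ^ (binary_order n).+1)%N.
Proof.
move=> n0.
have h := trunc_log_bounds (leqnn 2) n0.
have tn : (trunc_log 2 n < n)%N.
  by apply: leq_trans (ltn_expl _ (leqnn 2)) (proj1 (andP h)).
suff -> : binary_order n = trunc_log 2 n by [].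
apply/eqP; rewrite eqn_leq; apply/andP; split.
  apply/bigmax_leqP => -[j jn] /= dj; rewrite leqNgt; apply/negP => tj.
  move: dj; rewrite binary_digit_small//.
  by apply: leq_trans (proj2 (andP h)) _; rewrite leq_exp2l.
exact: (@leq_bigmax_cond _ _ (fun j : 'I_n => j : nat) (Ordinal tn) (binary_digit_top h)).
Qed.

Section walsh_functions.
Context (R : realType).
Local Notation walsh := (walsh R).
Local Notation dirichlet := (dirichlet R).
Local Notation rademacher := (rademacher R).

(** Digits of index at least [n] or at least [M] vanish, so both products equal the one over
    [k < n + M]. *)
Lemma walsh_widen n M x : (n < 2 ^ M)%N ->
  walsh n x = \prod_(k < M) rademacher k x ^+ binary_digit n k.
Proof.
move=> nM; set f := fun k => rademacher k x ^+ binary_digit n k.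
have h : \prod_(k < n + M) f k = \prod_(k < n) f k.
  rewrite big_split_ord /= [X in _ * X]big1 ?mulr1// => i _.
  rewrite /f binary_digit_small ?expr0//.
  by apply: leq_trans (ltn_expl _ (leqnn 2)) _; rewrite leq_exp2l ?leq_addr.
rewrite /walsh -[LHS]h addnC big_split_ord /= [X in _ * X]big1 ?mulr1// => i _.
rewrite /f binary_digit_small ?expr0//.
by apply: leq_trans nM _; rewrite leq_exp2l ?leq_addr.
Qed.

Lemma walsh_half n x :
  walsh n x = rademacher 0 x ^+ odd n * walsh n./2 (dshift x).
Proof.
have n2 : (n < 2 ^ n)%N by exact: ltn_expl.
rewrite (@walsh_widen n n.+1); last first.
  by apply: leq_trans n2 _; rewrite leq_exp2l.
rewrite big_ord_recl /binary_digit expn0 divn1; congr (_ * _).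
rewrite (@walsh_widen n./2 n); last by apply: leq_ltn_trans n2; rewrite -divn2 leq_div.
apply: eq_bigr => i _; rewrite -/(binary_digit _ _) /= /bump /= add1n.
by rewrite -/(binary_digit _ _) binary_digitS.
Qed.

Lemma walsh0 x : walsh 0 x = 1.
Proof. by rewrite /walsh big_ord0. Qed.

Lemma walshE n x : walsh n x = (-1) ^+ (\sum_(k < n) x k * binary_digit n k).
Proof.
by rewrite expr_sum; apply: eq_bigr => k _; rewrite /rademacher exprM.
Qed.

Lemma normr_walsh n x : `|walsh n x| = 1.
Proof. by rewrite walshE normrX normrN1 expr1n. Qed.

Lemma walsh_dadd n x y : walsh n (Defs.dadd x y) = walsh n x * walsh n y.
Proof.
rewrite /walsh -big_split /=; apply: eq_bigr => k _.
by rewrite /rademacher /Defs.dadd signr_addb exprMn.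
Qed.

Lemma walsh_cyl n M x y : (n < 2 ^ M)%N -> cyl M x y -> walsh n y = walsh n x.
Proof.
move=> nM xy; rewrite !(walsh_widen _ nM); apply: eq_bigr => k _.
by rewrite /rademacher xy.
Qed.

(** The top digit of [n] sits at [N], so the flip affects the single factor r_N. *)
Lemma walsh_dflip n N x : (2 ^ N <= n < 2 ^ N.+1)%N ->
  walsh n (dflip N x) = - walsh n x.
Proof.
move=> nN; have /andP[n1 n2] := nN.
rewrite /dflip walsh_dadd (walsh_widen _ n2) big_ord_recr /= big1; last first.
  by move=> i _; rewrite /rademacher (ltn_eqF (ltn_ord i)) expr0 expr1n.
rewrite (binary_digit_top nN) /rademacher. by rewrite eqxx !expr1 mul1r mulN1r.
Qed.

(** The terms pair off: w_(2k) + w_(2k+1) is 1 + r_0 times w_k at the shifted point. *)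
Lemma dirichlet_double n x :
  dirichlet n.*2 x = (1 + rademacher 0 x) * dirichlet n (dshift x).
Proof.
elim: n => [|n IH]; first by rewrite /dirichlet !big_ord0 mulr0.
rewrite doubleS /dirichlet !big_ord_recr /=; move: IH; rewrite /dirichlet => ->.
rewrite (walsh_half n.*2) (walsh_half n.*2.+1) /= odd_double uphalf_double.
by rewrite half_double expr0 expr1; ring.
Qed.

Lemma dirichlet_doubleS n x : dirichlet n.*2.+1 x =
  (1 + rademacher 0 x) * dirichlet n (dshift x) + walsh n (dshift x).
Proof.
rewrite {1}/dirichlet big_ord_recr /= -/(dirichlet _ _) dirichlet_double.
by rewrite (walsh_half n.*2) odd_double half_double expr0 mul1r.
Qed.

Lemma dirichlet1 x : dirichlet 1 x = 1.
Proof. by rewrite /dirichlet big_ord1 walsh0. Qed.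

Lemma dirichlet_pow2 N x :
  dirichlet (2 ^ N) x = 2 ^+ N * (x \in cyl N dzero)%:R.
Proof.
elim: N x => [|N IH] x.
  by rewrite expn0 dirichlet1 expr0 mul1r cyl0 in_setT.
rewrite expnS mul2n dirichlet_double IH mem_cyl0S /rademacher.
by case: (x 0%N) => /=; rewrite ?expr1 ?expr0 ?subrr ?mul0r ?mulr0// exprS mulrA.
Qed.

Lemma dirichlet_int n x : dirichlet n x \is a Num.int.
Proof. by apply: rpred_sum => k _; rewrite walshE rpredX ?rpredN1. Qed.

Lemma binary_ind (P : nat -> Prop) : P 1%N ->
  (forall n, (0 < n)%N -> P n -> P n.*2) ->
  (forall n, (0 < n)%N -> P n -> P n.*2.+1) -> forall n, (0 < n)%N -> P n.
Proof.
move=> P1 P2 P3; elim/ltn_ind => -[//|[//|n]] IH _.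
have h0 : (0 < n.+2./2)%N by rewrite half_gt0.
have hn : (n.+2./2 < n.+2)%N by rewrite -divn2 ltn_Pdiv.
rewrite -[X in P X]odd_double_half; have := IH _ hn h0.
by case: odd => ?; rewrite ?add0n ?add1n; [exact: P3|exact: P2].
Qed.

Lemma logn2_double n : (0 < n)%N -> logn 2 n.*2 = (logn 2 n).+1.
Proof. by move=> n0; rewrite -mul2n lognM// logn_prime. Qed.

Lemma logn2_doubleS n : logn 2 n.*2.+1 = 0%N.
Proof. by rewrite logn_coprime// coprime2n /= odd_double. Qed.

(** Each trailing zero of [n] gives a factor 1 + r_0, which kills the points of first digit 1; once
    the index is odd, the kernel vanishes nowhere. *)
Lemma supp_dirichletE n : (0 < n)%N ->
  supp_dirichlet R n = cyl (logn 2 n) dzero.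
Proof.
move=> n0; suff h x : (dirichlet n x != 0) = (x \in cyl (logn 2 n) dzero).
  by apply/seteqP; split=> x; rewrite /supp_dirichlet /= h in_setE.
move: n n0 x; apply: binary_ind => [x|n n0 IH x|n n0 _ x].
- by rewrite dirichlet1 oner_eq0 logn1 cyl0 in_setT.
- rewrite logn2_double// mem_cyl0S -IH dirichlet_double mulf_eq0 negb_or.
  rewrite /rademacher; case: (x 0%N); rewrite ?expr1 ?expr0 ?subrr ?eqxx//=.
  by rewrite (_ : (1 + 1 != 0 :> R) = true)//; apply/eqP; lra.
rewrite logn2_doubleS cyl0 in_setT dirichlet_doubleS.
(* The value is an even integer plus a sign, hence an odd integer. *)
have /intrP[z ->] := dirichlet_int n (dshift x).
rewrite walshE -signr_odd; set b := odd _; rewrite /rademacher.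
rewrite (_ : _ + _ = ((1 + (-1) ^+ x 0%N) * z + (-1) ^+ b)%:~R); last first.
  by rewrite rmorphD rmorphM rmorphD /= !rmorphXn /= !rmorphN /= !mulr1z.
rewrite intr_eq0; apply/eqP; case: (x 0%N); case: b; rewrite ?expr1 ?expr0; lia.
Qed.

(** Each trailing zero of [n] meets a digit 0 of [x] and doubles the kernel; at the lowest digit 1
    of [n] the digit of [x] is 1, so 1 + r_0 vanishes and a value of modulus 1 remains. *)
Lemma normr_dirichlet n x : (0 < n)%N -> x \in cyl (logn 2 n) dzero ->
  x (logn 2 n) -> `|dirichlet n x| = 2 ^+ logn 2 n.
Proof.
move=> n0; move: n n0 x; apply: binary_ind => [x _ _|n n0 IH x|n n0 _ x _].
- by rewrite dirichlet1 normr1 logn1.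
- rewrite logn2_double// mem_cyl0S => /andP[/negbTE x0 xl] xn.
  rewrite dirichlet_double normrM /rademacher x0 IH// exprS expr0.
  by rewrite ger0_norm.
rewrite logn2_doubleS => x0.
by rewrite dirichlet_doubleS /rademacher x0 expr1 subrr mul0r add0r normr_walsh.
Qed.

(** By induction on the binary expansion: the factor 1 + r_0 turns 2^j 1_(I_j) at the shifted point
    into 2^(j+1) 1_(I_(j+1)), and an odd index adds a Walsh value of modulus 1, which is the term j
    = 0. *)
Lemma normr_dirichlet_block n N x : (2 ^ N <= n < 2 ^ N.+1)%N ->
  `|dirichlet n x - dirichlet (2 ^ N) x| <=
  \sum_(logn 2 n <= j < N) 2 ^+ j * (x \in cyl j dzero)%:R.
Proof.
move=> nN; have n0 : (0 < n)%N.
  by apply: leq_trans (proj1 (andP nN)); rewrite expn_gt0.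
move: n n0 N nN x; apply: binary_ind => [|n n0 IH|n n0 IH] [|N] nN x.
- by rewrite subrr normr0 big_geq.
- by move: nN => /andP[]; rewrite leqNgt (@ltn_exp2l 2 0 N.+1).
- by move: nN n0; rewrite expn0 expn1; case: n {IH} => [//|n]; rewrite doubleS.
- rewrite logn2_double// expnS mul2n !dirichlet_double -mulrBr normrM.
  have nN' : (2 ^ N <= n < 2 ^ N.+1)%N.
    by move: nN; rewrite !(expnS _ N.+1) expnS !mul2n leq_double ltn_double.
  apply: (@le_trans _ _ (2 * (~~ x 0%N)%:R *
      \sum_(logn 2 n <= j < N) 2 ^+ j * (dshift x \in cyl j dzero)%:R)).
    apply: ler_pM => //; last exact: IH.
    by rewrite /rademacher; case: (x 0%N);
      rewrite ?expr1 ?expr0 /= ?subrr ?normr0 ?mulr0 ?mulr1// ger0_norm.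
  rewrite big_add1 /= mulr_sumr; apply: ler_sum => j _.
  rewrite mem_cyl0S exprS -mulnb natrM.
  by rewrite le_eqVlt; apply/orP; left; apply/eqP; ring.
- by move: nN n0; rewrite expn0 expn1; case: n {IH} => [//|n]; rewrite doubleS.
have nN' : (2 ^ N <= n < 2 ^ N.+1)%N.
  move: nN; rewrite !(expnS _ N.+1) expnS !mul2n ltn_Sdouble.
  by move=> /andP[h1 ->]; rewrite andbT -leq_Sdouble.
rewrite logn2_doubleS expnS mul2n dirichlet_doubleS dirichlet_double addrAC -mulrBr.
apply: (le_trans (ler_normD _ _)); rewrite normr_walsh normrM.
rewrite big_nat_recl// cyl0 in_setT expr0 mulr1 addrC lerD2l.
apply: (@le_trans _ _ (2 * (~~ x 0%N)%:R *
      \sum_(logn 2 n <= j < N) 2 ^+ j * (dshift x \in cyl j dzero)%:R)).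
  apply: ler_pM => //; last exact: IH.
  by rewrite /rademacher; case: (x 0%N);
    rewrite ?expr1 ?expr0 /= ?subrr ?normr0 ?mulr0 ?mulr1// ger0_norm.
rewrite [leRHS](eq_bigr (fun j =>
  2 * (~~ x 0%N)%:R * (2 ^+ j * (dshift x \in cyl j dzero)%:R))); last first.
  by move=> j _; rewrite mem_cyl0S exprS -mulnb natrM; ring.
rewrite -mulr_sumr ler_wpM2l ?mulr_ge0//.
(* Only the ranges differ: the sum starts at [logn 2 n] on the left and at 0 on the right, and its
   terms are nonnegative. *)
have [lN|lN] := leqP (logn 2 n) N; last by rewrite big_geq ?(ltnW lN)// sumr_ge0// =>
  j _; rewrite mulr_ge0 ?exprn_ge0.
by rewrite (big_cat_nat (leq0n _) lN) /= lerDr sumr_ge0// => j _;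
  rewrite mulr_ge0 ?exprn_ge0.
Qed.

End walsh_functions.

(** * Integrals over cylinders and the L_p estimate *)

Section powR_subadditivity.
Context (R : realType) (p : R) (p_gt0 : 0 < p) (p_le1 : p <= 1).

Lemma ler_powRD (a b : R) : 0 <= a -> 0 <= b ->
  (a + b) `^ p <= a `^ p + b `^ p.
Proof.
move=> a0 b0; have [ab0|ab_neq0] := eqVneq (a + b) 0.
  by rewrite ab0 powR0 ?gt_eqF// addr_ge0 ?powR_ge0.
have ab : 0 < a + b by rewrite lt_def ab_neq0 addr_ge0.
(* A ratio u in [0, 1] satisfies u <= u^p; this is applied to a / (a + b) and b / (a + b), whose sum
   is 1. *)
have key c : 0 <= c -> c <= a + b -> (a + b) `^ p * (c / (a + b)) <= c `^ p.
  rewrite le_eqVlt => /predU1P[<-|c0] cab; first by rewrite mul0r mulr0 powR_ge0.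
  have -> : c `^ p = (a + b) `^ p * (c / (a + b)) `^ p.
    by rewrite -powRM ?divr_ge0 ?(ltW c0) ?(ltW ab)// mulrC divfK.
  by rewrite ler_wpM2l ?powR_ge0// ger1_powR// divr_gt0//= ler_pdivrMr// mul1r.
have -> : (a + b) `^ p =
    (a + b) `^ p * (a / (a + b)) + (a + b) `^ p * (b / (a + b)).
  by rewrite -mulrDr -mulrDl divff// mulr1.
by rewrite lerD// key// ?lerDl ?lerDr.
Qed.

Lemma ler_powR_sum (I : Type) (r : seq I) (P : pred I) (f : I -> R) :
  (forall i, P i -> 0 <= f i) ->
  (\sum_(i <- r | P i) f i) `^ p <= \sum_(i <- r | P i) f i `^ p.
Proof.
move=> f0; suff [] : 0 <= \sum_(i <- r | P i) f i /\
  (\sum_(i <- r | P i) f i) `^ p <= \sum_(i <- r | P i) f i `^ p by [].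
apply: (big_rec2 (fun x y => 0 <= x /\ x `^ p <= y)).
  by rewrite powR0 ?gt_eqF.
move=> i y1 y2 Pi [y10 y1y2]; split; first by rewrite addr_ge0 ?f0.
by apply: (le_trans (ler_powRD (f0 _ Pi) y10)); rewrite lerD2l.
Qed.

End powR_subadditivity.

Lemma powRV (R : realType) (a r : R) : 0 <= a -> a^-1 `^ r = (a `^ r)^-1.
Proof. by move=> a0; rewrite -powR_inv1// -powRrM mulN1r powRN. Qed.

(** Descending induction on the length of a cylinder, which splits into the cylinders of length
    [j.+1] at [x] and at [dflip j x]. *)
Lemma cyl_down_ind (P : nat -> dyadic_group -> Prop) N :
  (forall x, P N x) ->
  (forall j x, (j < N)%N -> P j.+1 x -> P j.+1 (dflip j x) -> P j x) ->
  forall j x, (j <= N)%N -> P j x.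
Proof.
move=> PN PS j x jN; rewrite -(subKn jN).
elim: (N - j)%N (leq_subr j N) x => [_ x|k IH kN x]; first by rewrite subn0.
have e : (N - k = (N - k.+1).+1)%N by rewrite subnSK.
apply: PS; first by move: kN; lia.
- by rewrite -e; apply: IH; exact: ltnW.
- by rewrite -e; apply: IH; exact: ltnW.
Qed.

(** * Functions constant on cylinders of a given length *)

Section zeta_measurable_theory.
Context (R : realType).
Implicit Types f g : dyadic_group -> R.

Lemma zeta_measurableP n f :
  zeta_measurable n f <-> forall x y, cyl n x y -> f y = f x.
Proof.
split=> [mf x y|hf B _]; first exact: zeta_measurable_const.
by apply/zetaP => x /= Bx y xy /=; rewrite (hf x).
Qed.

Lemma zeta_measurable_le n m f : (n <= m)%N ->
  zeta_measurable n f -> zeta_measurable m f.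
Proof.
move=> nm /zeta_measurableP hf; apply/zeta_measurableP => x y xy.
by apply: hf => k kn; apply: xy; exact: leq_trans nm.
Qed.

Lemma zeta_measurable_op1 n (op : R -> R) f :
  zeta_measurable n f -> zeta_measurable n (fun x => op (f x)).
Proof.
by move=> /zeta_measurableP h; apply/zeta_measurableP => x y /h ->.
Qed.

Lemma zeta_measurable_op2 n (op : R -> R -> R) f g :
  zeta_measurable n f -> zeta_measurable n g ->
  zeta_measurable n (fun x => op (f x) (g x)).
Proof.
move=> /zeta_measurableP hf /zeta_measurableP hg.
by apply/zeta_measurableP => x y xy; rewrite (hf x)// (hg x).
Qed.

Lemma zeta_measurable_sum (I : Type) (r : seq I) (P : pred I)
    (f : I -> dyadic_group -> R) n :
  (forall i, P i -> zeta_measurable n (f i)) ->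
  zeta_measurable n (fun x => \sum_(i <- r | P i) f i x).
Proof.
move=> hf; apply/zeta_measurableP => x y xy; apply: eq_bigr => i Pi.
by move/zeta_measurableP : (hf _ Pi); exact.
Qed.

Lemma zeta_measurable_walsh n k : (k < 2 ^ n)%N -> zeta_measurable n (walsh R k).
Proof. by move=> kn; apply/zeta_measurableP => x y; exact: walsh_cyl. Qed.

Lemma zeta_measurable_measurable n f :
  zeta_measurable n f -> measurable_fun [set: dyadic_group] f.
Proof. by move=> mf _ B mB; rewrite setTI; apply: (@zeta_sub_measurable n);
  exact: mf. Qed.

Lemma zeta_measurable_bounded n f : zeta_measurable n f ->
  exists M, forall x, `|f x| <= M.
Proof.
move=> mf.
suff [M hM] : exists M, forall y, cyl 0 dzero y -> `|f y| <= M.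
  by exists M => x; apply: hM.
move: (leq0n n).
apply: (@cyl_down_ind (fun j x => exists M, forall y, cyl j x y -> `|f y| <= M)).
  by move=> x; exists `|f x| => y xy; rewrite (zeta_measurable_const mf xy).
move=> j x jn [M1 h1] [M2 h2]; exists (Num.max M1 M2) => y.
by rewrite cylS => -[/h1|/h2] h; rewrite le_max h ?orbT.
Qed.

End zeta_measurable_theory.

(** * Splitting integrals along cylinders *)

Section cylinder_integrals.
Context (R : realType) (mu : probability dyadic_group R) (mu_haar : haar mu).
Implicit Types f g : dyadic_group -> R.
Local Notation integrable f := (mu.-integrable [set: dyadic_group] (EFin \o f)).

Lemma zeta_integrable n f : zeta_measurable n f -> integrable f.
Proof.
move=> mf; apply: measurable_bounded_integrable => //.
- by apply: (@le_lt_trans _ _ 1%E); [exact: probability_le1|exact: ltry].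
- exact: zeta_measurable_measurable mf.
have [M hM] := zeta_measurable_bounded mf.
exists M; split=> [|M' hM' x _ /=]; first exact: num_real.
exact: le_trans (hM x) (ltW hM').
Qed.

Lemma Rintegral_cylS j x f : integrable f ->
  \int[mu]_(y in cyl j x) f y =
  \int[mu]_(y in cyl j.+1 x) f y + \int[mu]_(y in cyl j.+1 (dflip j x)) f y.
Proof.
move=> intf; rewrite cylS Rintegral_setU//; try exact: measurable_cyl.
- apply: integrableS intf => //; apply: measurableU; exact: measurable_cyl.
- by apply/disj_setPS; rewrite cylS_disjoint.
Qed.

Lemma eq_Rintegral_cyl N f g : integrable f -> integrable g ->
  (forall x, \int[mu]_(y in cyl N x) f y = \int[mu]_(y in cyl N x) g y) ->
  forall j x, (j <= N)%N ->
  \int[mu]_(y in cyl j x) f y = \int[mu]_(y in cyl j x) g y.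
Proof.
move=> intf intg fg; apply: cyl_down_ind => // j x jN h1 h2.
by rewrite (Rintegral_cylS j x intf) (Rintegral_cylS j x intg) h1 h2.
Qed.

(** The two halves of a cylinder of length [N] contribute opposite amounts, and shorter cylinders
    are unions of those. *)
Lemma Rintegral_cyl_anti N h : zeta_measurable N.+1 h ->
  (forall x, h (dflip N x) = - h x) ->
  forall j x, (j <= N)%N -> \int[mu]_(y in cyl j x) h y = 0.
Proof.
move=> mh hN; have ih := zeta_integrable mh; apply: cyl_down_ind => [x|j x jN].
  by rewrite Rintegral_cylS// !(Rintegral_cyl mu_haar)// hN mulNr subrr.
by rewrite (Rintegral_cylS j x ih) => -> ->; rewrite addr0.
Qed.

Lemma Rintegral_cylM N f h x : integrable f -> zeta_measurable N h ->
  \int[mu]_(y in cyl N x) (f y * h y) = (\int[mu]_(y in cyl N x) f y) * h x.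
Proof.
move=> intf mh; rewrite -RintegralZr; last 2 first.
- exact: measurable_cyl.
- by apply: integrableS intf => //; exact: measurable_cyl.
apply: eq_Rintegral => y /set_mem xy.
by rewrite (zeta_measurable_const mh xy).
Qed.

Lemma Rintegral_cyl0 f : \int[mu]_(y in cyl 0 dzero) f y = \int[mu]_y f y.
Proof. by rewrite cyl0. Qed.

Lemma RintegralT_cond_exp n f : integrable f ->
  \int[mu]_x cond_exp mu n f x = \int[mu]_x f x.
Proof.
by move=> /(cond_expP mu_haar n)[_ _]; apply; apply/zetaP => x _.
Qed.

Lemma cond_exp_id n f : zeta_measurable n f -> cond_exp mu n f = f.
Proof.
move=> mf; apply/funext => x; rewrite (cond_expE mu_haar)//; last first.
  exact: zeta_integrable mf.
by rewrite (Rintegral_cyl mu_haar)// mulrCA divff ?mulr1// expf_neq0.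
Qed.

Lemma cond_expD n f g x : integrable f -> integrable g ->
  cond_exp mu n (fun y => f y + g y) x = cond_exp mu n f x + cond_exp mu n g x.
Proof.
move=> intf intg; have mc := @measurable_cyl n x.
have intD : integrable (fun y => f y + g y).
  exact: (integrableD measurableT intf intg).
rewrite !(cond_expE mu_haar)//.
by rewrite RintegralD ?mulrDr//; apply: integrableS (_ : integrable _).
Qed.

Lemma Rintegral_sum (A : set dyadic_group) (I : Type) (r : seq I)
    (f : I -> dyadic_group -> R) n : measurable A ->
  (forall i, zeta_measurable n (f i)) ->
  \int[mu]_(x in A) (\sum_(i <- r) f i x) = \sum_(i <- r) \int[mu]_(x in A) f i x.
Proof.
move=> mA mf; have intA g : zeta_measurable n g -> mu.-integrable A (EFin \o g).
  by move=> /zeta_integrable; exact: integrableS.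
elim: r => [|i r IH].
  rewrite big_nil; under eq_Rintegral do rewrite big_nil.
  by rewrite Rintegral_cst// mul0r.
rewrite big_cons -IH -RintegralD//.
- by apply: eq_Rintegral => x _; rewrite big_cons.
- by apply: intA; exact: mf.
- by apply: intA; exact: zeta_measurable_sum.
Qed.

Lemma zeta_measurable_cyl_integral j f :
  zeta_measurable j (fun x => \int[mu]_(y in cyl j x) f y).
Proof. by apply/zeta_measurableP => x y /cyl_eq ->. Qed.

(** The inner integral is 2^(-j) times the conditional expectation, whose integral is that of
    [f]. *)
Lemma Rintegral_cyl_integral j f : integrable f ->
  \int[mu]_x (\int[mu]_(y in cyl j x) f y) = (\int[mu]_x f x) / 2 ^+ j.
Proof.
move=> intf; rewrite -(RintegralT_cond_exp j intf).
have [_ intc _] := cond_expP mu_haar j intf.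
rewrite mulrC -(RintegralZl _ measurableT intc).
apply: eq_Rintegral => x _; rewrite (cond_expE mu_haar j x intf).
by rewrite mulKf// expf_neq0.
Qed.

End cylinder_integrals.

(** * The L_p estimate for a section of a Walsh series *)

Section block_estimate.
Context (R : realType) (mu : probability dyadic_group R) (mu_haar : haar mu).
Context (p : R) (p_gt0 : 0 < p) (p_lt1 : p < 1).
Implicit Types d : dyadic_group -> R.

(** On a cylinder of length [N] where |d| = a, both sides equal (a 2^(-N))^p; subadditivity of the
    p-th power carries the bound to shorter cylinders. *)
Lemma powR_cyl_integral N d : zeta_measurable N d ->
  forall j x, (j <= N)%N -> (\int[mu]_(y in cyl j x) `|d y|) `^ p <=
    (2 ^+ N) `^ (1 - p) * \int[mu]_(y in cyl j x) `|d y| `^ p.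
Proof.
move=> md; have md1 := zeta_measurable_op1 Num.norm md.
have mdp := zeta_measurable_op1 (@powR R ^~ p) md1.
apply: cyl_down_ind => [x|j x jN h1 h2].
  have c0 : 0 < 2 ^+ N :> R by rewrite exprn_gt0.
  rewrite !(Rintegral_cyl mu_haar)// powRM ?invr_ge0 ?(ltW c0)//.
  rewrite powRV ?(ltW c0)// powRB; last by rewrite gt_eqF ?implybT.
  rewrite powRr1 ?(ltW c0)// le_eqVlt; apply/orP; left; apply/eqP.
  by field; rewrite !gt_eqF// powR_gt0.
rewrite (Rintegral_cylS j x (zeta_integrable mu md1)).
rewrite (Rintegral_cylS j x (zeta_integrable mu mdp)) mulrDr.
apply: le_trans (ler_powRD p_gt0 (ltW p_lt1) _ _) _; try exact: Rintegral_ge0.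
exact: lerD.
Qed.

Lemma sum_walsh_range a m x : (a <= m)%N ->
  \sum_(a <= k < m) walsh R k x = dirichlet R m x - dirichlet R a x.
Proof.
move=> am; rewrite /dirichlet -!(big_mkord xpredT (fun k => walsh R k x)).
by rewrite (big_cat_nat (leq0n _) am) /= [RHS]addrC addKr.
Qed.

(** The part of the Walsh series of [d] with frequencies in [a, b). *)
Definition walsh_section (a b : nat) d (x : dyadic_group) : R :=
  \sum_(a <= k < b) (\int[mu]_t (d t * walsh R k t)) * walsh R k x.

(** A convolution kernel: x + t and x - t coincide in this group. *)
Let kernel a b (x t : dyadic_group) : R :=
  dirichlet R b (Defs.dadd x t) - dirichlet R a (Defs.dadd x t).

Lemma zeta_measurable_walsh_section a b n d : (b <= 2 ^ n)%N ->
  zeta_measurable n (walsh_section a b d).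
Proof.
move=> bn; apply/zeta_measurableP => x y xy; rewrite /walsh_section !big_nat.
apply: eq_bigr => k /andP[_ kb]; congr (_ * _); apply: walsh_cyl xy.
exact: leq_trans bn.
Qed.

Lemma zeta_measurable_kernel a b n x : (a <= b)%N -> (b <= 2 ^ n)%N ->
  zeta_measurable n (kernel a b x).
Proof.
move=> ab bn; apply/zeta_measurableP => s t st.
rewrite /kernel -!sum_walsh_range// !big_nat; apply: eq_bigr => k /andP[_ kb].
by rewrite !walsh_dadd (walsh_cyl _ (leq_trans kb bn) st).
Qed.

Lemma walsh_sectionE a b n d x : (a <= b)%N -> (b <= 2 ^ n)%N ->
  zeta_measurable n d ->
  walsh_section a b d x = \int[mu]_t (d t * kernel a b x t).
Proof.
move=> ab bn md.
(* Putting 0 for [k >= b] makes every [w k] measurable for [zeta n], as [Rintegral_sum] asks of all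
   indices. The functions [G] below are cut off for the same reason. *)
pose w k t := if (k < b)%N then walsh R k t else 0.
have mw k : zeta_measurable n (w k).
  rewrite /w; case: (boolP (k < b)%N) => kb; last by apply/zeta_measurableP.
  by apply: zeta_measurable_walsh; exact: leq_trans bn.
have KE t : kernel a b x t = \sum_(a <= k < b) w k t * walsh R k x.
  rewrite /kernel -sum_walsh_range// !big_nat; apply: eq_bigr => k /andP[_ kb].
  by rewrite /w kb walsh_dadd mulrC.
under eq_Rintegral do rewrite KE mulr_sumr.
rewrite (@Rintegral_sum _ _ _ _ _ _ n)//; last first.
  move=> k; apply: (zeta_measurable_op2 *%R) => //.
  exact: (zeta_measurable_op1 ( *%R^~ _)).
rewrite /walsh_section !big_nat; apply: eq_bigr => k /andP[_ kb].
rewrite -RintegralZr//; last first.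
  apply: (@zeta_integrable _ _ n); apply: (zeta_measurable_op2 *%R) => //.
  by apply: zeta_measurable_walsh; exact: leq_trans bn.
by apply: eq_Rintegral => t _; rewrite /w kb mulrA.
Qed.

Lemma mem_cyl_dadd j x t : (Defs.dadd x t \in cyl j dzero) = (t \in cyl j x).
Proof.
apply/idP/idP => /set_mem h; apply/mem_set => k kj.
  by have := h k kj; rewrite /Defs.dadd /dzero; case: (x k) (t k) => -[].
by rewrite /Defs.dadd h// addbb.
Qed.

Lemma Rintegral_cyl_mem j x (f : dyadic_group -> R) :
  \int[mu]_t (f t * (t \in cyl j x)%:R) = \int[mu]_(t in cyl j x) f t.
Proof.
rewrite [RHS]Rintegral_mkcond; apply: eq_Rintegral => t _; rewrite patchE.
by case: (t \in _); rewrite ?mulr1 ?mulr0.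
Qed.

Lemma zeta_measurable_mem_cyl j n x : (j <= n)%N ->
  zeta_measurable n (fun t => (t \in cyl j x)%:R : R).
Proof.
move=> jn; apply: (zeta_measurable_le jn); apply/zeta_measurableP => u v uv.
rewrite -(mem_cyl_dadd j x u) -(mem_cyl_dadd j x v); congr (_ %:R); congr nat_of_bool.
apply/idP/idP => /set_mem h; apply/mem_set => k kj; have := h k kj;
  by rewrite /Defs.dadd uv.
Qed.

(** Convolution with D_(2^N), which is 2^N on I_N and 0 elsewhere, averages over the cylinders of
    length [N], where [d] is constant. *)
Lemma walsh_section_pow2 N d : zeta_measurable N d ->
  walsh_section 0 (2 ^ N) d = d.
Proof.
move=> md; apply/funext => x; rewrite (@walsh_sectionE _ _ N)//.
under eq_Rintegral do
  rewrite /kernel {2}/dirichlet big_ord0 subr0 dirichlet_pow2 mem_cyl_dadd mulrCA.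
rewrite RintegralZl//; last first.
  apply: (@zeta_integrable _ _ N); apply: (zeta_measurable_op2 *%R) => //.
  exact: zeta_measurable_mem_cyl.
by rewrite Rintegral_cyl_mem (Rintegral_cyl mu_haar)// mulrCA divff ?mulr1.
Qed.

(** The section is a convolution with D_m - D_(2^N); translation by [x] moves the cylinders of
    [normr_dirichlet_block] from 0 to [x]. *)
Lemma normr_walsh_section N m d x : (2 ^ N <= m < 2 ^ N.+1)%N ->
  zeta_measurable N.+1 d -> `|walsh_section (2 ^ N) m d x| <=
    \sum_(logn 2 m <= j < N) 2 ^+ j * \int[mu]_(y in cyl j x) `|d y|.
Proof.
move=> mN md; have /andP[m1 m2] := mN.
rewrite (@walsh_sectionE _ _ N.+1)//; last exact: ltnW.
have mdK : zeta_measurable N.+1 (fun t => d t * kernel (2 ^ N) m x t).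
  by apply: (zeta_measurable_op2 *%R) => //; apply: zeta_measurable_kernel => //;
    exact: ltnW.
apply: (le_trans (le_normr_Rintegral _ _)) => //; first exact: zeta_integrable mdK.
pose G j t := if (j < N)%N then 2 ^+ j * (`|d t| * (t \in cyl j x)%:R) else 0.
have mdj j : (j < N)%N ->
    zeta_measurable N.+1 (fun t => `|d t| * (t \in cyl j x)%:R).
  move=> jN; apply: (zeta_measurable_op2 *%R); first exact: zeta_measurable_op1.
  by apply: zeta_measurable_mem_cyl; rewrite ltnW// ltnW.
have mG j : zeta_measurable N.+1 (G j).
  rewrite /G; case: (boolP (j < N)%N) => jN; last by apply/zeta_measurableP.
  by apply: (zeta_measurable_op1 ( *%R _)); exact: mdj.
apply: (@le_trans _ _ (\int[mu]_t \sum_(logn 2 m <= j < N) G j t)).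
  apply: le_Rintegral => //.
  - by apply: (@zeta_integrable _ _ N.+1); exact: zeta_measurable_op1.
  - by apply: (@zeta_integrable _ _ N.+1); exact: zeta_measurable_sum.
  move=> t _; rewrite normrM.
  have := ler_wpM2l (normr_ge0 (d t)) (normr_dirichlet_block R (Defs.dadd x t) mN).
  move=> /le_trans; apply; rewrite mulr_sumr !big_nat.
  apply: ler_sum => j /andP[_ jN].
  by rewrite /G jN mulrCA mem_cyl_dadd.
rewrite (Rintegral_sum mu _ measurableT mG) !big_nat; apply: ler_sum => j /andP[_ jN].
rewrite /G jN RintegralZl//; last by apply: (@zeta_integrable _ _ N.+1); exact: mdj.
by rewrite Rintegral_cyl_mem.
Qed.

(* 2^(1 - p) times the sum of the geometric series of ratio 2^(p - 1). *)
Definition block_constant : R := 2 `^ (1 - p) / (1 - 2 `^ (p - 1)).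

Let q : R := 2 `^ (p - 1).

Let q_itv : 0 < q < 1.
Proof.
rewrite powR_gt0//= /q -[p - 1]opprB powRN invf_lt1 ?powR_gt0//.
have p1 : 0 < 1 - p by rewrite subr_gt0.
have := @gt0_ltr_powR R _ p1 1 2; rewrite !nnegrE powR1.
by apply; rewrite ?ltr1n.
Qed.

Lemma block_constant_ge0 : 0 <= block_constant.
Proof.
have /andP[_ q1] := q_itv.
by rewrite divr_ge0 ?powR_ge0// subr_ge0 ltW.
Qed.

Lemma powR_exprn (a : R) n : 0 <= a -> (2 ^+ n) `^ a = (2 `^ a) ^+ n.
Proof.
by move=> a0; rewrite -powR_mulrn// -powRrM mulrC powRrM powR_mulrn ?powR_ge0.
Qed.

(** Subadditivity passes the p-th power to each term of [normr_walsh_section], and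
    [powR_cyl_integral] bounds it. After integration the terms form a geometric series of ratio
    [q < 1], controlled by its first index [l]. *)
Lemma walsh_section_Lp N m d : (2 ^ N <= m < 2 ^ N.+1)%N ->
  zeta_measurable N.+1 d ->
  \int[mu]_x `|walsh_section (2 ^ N) m d x| `^ p <=
  block_constant * (m%:R / 2 ^+ logn 2 m) `^ (1 - p) * \int[mu]_x `|d x| `^ p.
Proof.
move=> mN md; have /andP[m1 m2] := mN; set l := logn 2 m.
have p1 : 0 <= 1 - p by rewrite subr_ge0 ltW.
have /andP[q0 q1] := q_itv.
pose B j x := \int[mu]_(y in cyl j x) `|d y| `^ p.
have mdp := zeta_measurable_op1 (fun u => `|u| `^ p) md.
pose c j := (2 ^+ j) `^ p * (2 ^+ N.+1) `^ (1 - p) : R.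
pose G j x := if (j < N)%N then c j * B j x else 0.
have mG j : zeta_measurable N.+1 (G j).
  rewrite /G; case: (boolP (j < N)%N) => jN; last by apply/zeta_measurableP.
  apply: (@zeta_measurable_le _ j); first by rewrite ltnW// ltnW.
  apply: (zeta_measurable_op1 ( *%R _)); exact: zeta_measurable_cyl_integral.
have mP : zeta_measurable N.+1 (walsh_section (2 ^ N) m d).
  by apply: zeta_measurable_walsh_section; exact: ltnW.
apply: (@le_trans _ _ (\int[mu]_x \sum_(l <= j < N) G j x)).
  apply: le_Rintegral => //.
  - by apply: (@zeta_integrable _ _ N.+1); exact: (zeta_measurable_op1 (fun u =>
    `|u| `^ p)).
  - by apply: (@zeta_integrable _ _ N.+1); exact: zeta_measurable_sum.
  move=> x _.
  have A0 j : 0 <= 2 ^+ j * \int[mu]_(y in cyl j x) `|d y|.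
    by rewrite mulr_ge0 ?exprn_ge0// Rintegral_ge0.
  apply: (@le_trans _ _ ((\sum_(l <= j < N) 2 ^+ j * \int[mu]_(y in cyl j x) `|d y|)
    `^ p)).
    apply: ge0_ler_powR; rewrite ?nnegrE ?(ltW p_gt0)//; first exact: sumr_ge0.
    exact: normr_walsh_section.
  apply: (le_trans (ler_powR_sum p_gt0 (ltW p_lt1) _ _)) => //.
  rewrite !big_nat; apply: ler_sum => j /andP[_ jN]; rewrite /G jN.
  rewrite powRM ?exprn_ge0 ?Rintegral_ge0// /c -mulrA ler_wpM2l ?powR_ge0//.
  by apply: powR_cyl_integral => //; rewrite ltnW// ltnW.
rewrite (Rintegral_sum mu _ measurableT mG).
have -> : \sum_(l <= j < N) \int[mu]_x G j x =
    (2 ^+ N.+1) `^ (1 - p) * (\int[mu]_x `|d x| `^ p) * \sum_(l <= j < N) q ^+ j.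
  rewrite mulr_sumr !big_nat; apply: eq_bigr => j /andP[_ jN]; rewrite /G jN.
  have ji : mu.-integrable setT (EFin \o B j).
    by apply: (@zeta_integrable _ _ j); exact: zeta_measurable_cyl_integral.
  rewrite RintegralZl// Rintegral_cyl_integral//; last exact: zeta_integrable mdp.
  have -> : q = 2 `^ p / 2 by rewrite /q powRB ?pnatr_eq0 ?implybT// powRr1.
  by rewrite /c powR_exprn ?(ltW p_gt0)// expr_div_n; ring.
have J0 : 0 <= \int[mu]_x `|d x| `^ p by apply: Rintegral_ge0 => x _; exact: powR_ge0.
have geo : \sum_(l <= j < N) q ^+ j <= q ^+ l / (1 - q).
  have [lN|lN] := leqP l N; last first.
    by rewrite big_geq ?(ltnW lN)// divr_ge0 ?exprn_ge0 ?(ltW q0)// subr_ge0 ltW.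
  rewrite ler_pdivlMr ?subr_gt0// mulrC.
  suff -> : (1 - q) * \sum_(l <= j < N) q ^+ j = q ^+ l - q ^+ N.
    by rewrite gerBl exprn_ge0// ltW.
  rewrite mulr_sumr (@telescope_sumr_eq _ _ _ (fun j => - q ^+ j))// ?opprK 1?addrC//.
  by move=> j _; rewrite exprS; ring.
have q_l : q ^+ l = ((2 ^+ l) `^ (1 - p))^-1.
  by rewrite powR_exprn// -exprVn -powRN opprB.
apply: le_trans (ler_wpM2l _ geo) _; first by rewrite mulr_ge0 ?powR_ge0.
(* Passing from N + 1 to N gives the factor 2^(1 - p) of [block_constant]; then 2^N is bounded by
   [m]. *)
have -> : (2 ^+ N.+1) `^ (1 - p) * \int[mu]_x `|d x| `^ p * (q ^+ l / (1 - q)) =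
    block_constant * ((2 ^+ N) `^ (1 - p) * q ^+ l) * \int[mu]_x `|d x| `^ p.
  by rewrite /block_constant -/q exprS powRM ?exprn_ge0//; ring.
rewrite ler_wpM2r// ler_wpM2l ?block_constant_ge0//.
rewrite powRM ?ler0n ?invr_ge0 ?exprn_ge0// powRV ?exprn_ge0// -q_l.
rewrite ler_wpM2r ?exprn_ge0 ?(ltW q0)//.
apply: ge0_ler_powR; rewrite ?nnegrE ?exprn_ge0 ?ler0n//.
by rewrite -natrX ler_nat.
Qed.

End block_estimate.

(** * Partial sums in H_p *)

Section partial_sums.
Context (R : realType) (mu : probability dyadic_group R) (mu_haar : haar mu).
Context (F : nat -> dyadic_group -> R) (mF : dyadic_martingale mu F).
Local Notation integrable f := (mu.-integrable [set: dyadic_group] (EFin \o f)).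

Let F_zeta n : zeta_measurable n (F n).
Proof. by case: mF. Qed.

Let F_int n : integrable (F n).
Proof. by case: mF. Qed.

Lemma martingale_cond_exp n m :
  cond_exp mu n (F m) = if (n <= m)%N then F n else F m.
Proof.
case: leqP => nm; first by case: mF => _ _; exact.
by apply: cond_exp_id => //; exact: (zeta_measurable_le (ltnW nm) (@F_zeta m)).
Qed.

Lemma martingale_cyl_integral n m x : (n <= m)%N ->
  \int[mu]_(y in cyl n x) F m y = \int[mu]_(y in cyl n x) F n y.
Proof.
move=> nm; have h := martingale_cond_exp n m; rewrite nm in h.
rewrite [RHS](Rintegral_cyl mu_haar)// -h (cond_expE mu_haar)//.
by rewrite mulrC mulKf// expf_neq0.
Qed.

(** As w_k is constant on cylinders of length [n], the integrals no longer change from rank [n] on,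
    and the limit is attained. *)
Lemma fourier_coefE n k : (k < 2 ^ n)%N ->
  fourier_coef mu F k = \int[mu]_x (F n x * walsh R k x).
Proof.
move=> kn; apply: norm_lim_near_cst; exists n => // m /= nm.
rewrite -!Rintegral_cyl0; apply: (@eq_Rintegral_cyl _ _ n) => //.
- apply: (@zeta_integrable _ _ m); apply: (zeta_measurable_op2 *%R) => //.
  apply: zeta_measurable_walsh; apply: (leq_trans kn).
  by rewrite leq_exp2l.
- apply: (@zeta_integrable _ _ n); apply: (zeta_measurable_op2 *%R) => //.
  exact: zeta_measurable_walsh.
move=> x; have mw := @zeta_measurable_walsh R _ _ kn.
by rewrite !Rintegral_cylM// martingale_cyl_integral.
Qed.

Lemma partial_sum_pow2 N : partial_sum mu (2 ^ N) F = F N.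
Proof.
rewrite -[RHS](walsh_section_pow2 mu_haar (@F_zeta N)); apply/funext => x.
rewrite /partial_sum /walsh_section big_mkord; apply: eq_bigr => k _.
by rewrite (@fourier_coefE N).
Qed.

Let diff N x := F N.+1 x - F N x.

Lemma zeta_measurable_diff N : zeta_measurable N.+1 (diff N).
Proof.
apply: (zeta_measurable_op2 (fun a b => a - b)) => //.
exact: (zeta_measurable_le (leqnSn N)).
Qed.

(** The flip of coordinate [N] preserves F_N and changes the sign of w_k, so F_N contributes
    nothing. *)
Lemma fourier_coef_diff N k : (2 ^ N <= k < 2 ^ N.+1)%N ->
  fourier_coef mu F k = \int[mu]_x (diff N x * walsh R k x).
Proof.
move=> kN; have /andP[k1 k2] := kN; rewrite (fourier_coefE k2).
have mw := @zeta_measurable_walsh R _ _ k2.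
have mFw : zeta_measurable N.+1 (fun x => F N x * walsh R k x).
  by apply: (zeta_measurable_op2 *%R) => //; exact: (zeta_measurable_le (leqnSn N)).
have mFw' : zeta_measurable N.+1 (fun x => F N.+1 x * walsh R k x).
  exact: (zeta_measurable_op2 *%R).
rewrite /diff; under [RHS]eq_Rintegral do rewrite mulrBl.
rewrite RintegralB//; [|exact: zeta_integrable mFw'|exact: zeta_integrable mFw].
rewrite -[X in _ - X]Rintegral_cyl0 (Rintegral_cyl_anti mu_haar mFw) ?subr0// => x.
rewrite walsh_dflip// mulrN; congr (- (_ * _)).
apply: (zeta_measurable_const (@F_zeta N)) => j jN.
by rewrite /dflip /Defs.dadd (ltn_eqF jN).
Qed.

Lemma partial_sum_block N m : (2 ^ N <= m < 2 ^ N.+1)%N ->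
  partial_sum mu m F = fun x => F N x + walsh_section mu (2 ^ N) m (diff N) x.
Proof.
move=> /andP[m1 m2]; apply/funext => x; rewrite -[in RHS]partial_sum_pow2.
rewrite /partial_sum -!(big_mkord xpredT (fun k => fourier_coef mu F k * walsh R k x)).
rewrite (big_cat_nat (leq0n _) m1) /=; congr (_ + _).
rewrite /walsh_section !big_nat; apply: eq_bigr => k /andP[k1 k2].
by rewrite (@fourier_coef_diff N)// k1 (ltn_trans k2).
Qed.

(** All frequencies involved change sign under the flip of coordinate [N], so the averages over
    cylinders of length at most [N] vanish. *)
Lemma cond_exp_block N m d j : (m <= 2 ^ N.+1)%N ->
  cond_exp mu j (walsh_section mu (2 ^ N) m d) =
  if (j <= N)%N then fun=> 0 else walsh_section mu (2 ^ N) m d.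
Proof.
move=> mN; have mP := zeta_measurable_walsh_section mu (2 ^ N) d mN.
case: leqP => jN; last first.
  by apply: cond_exp_id => //; exact: zeta_measurable_le jN mP.
apply/funext => x; rewrite (cond_expE mu_haar); last exact: zeta_integrable mP.
rewrite (Rintegral_cyl_anti mu_haar mP) ?mulr0// => y.
rewrite /walsh_section -sumrN !big_nat; apply: eq_bigr => k /andP[k1 k2].
by rewrite walsh_dflip ?mulrN// k1 (leq_trans k2).
Qed.

(** S_(2^N) F is F_N, whose martingale is F stopped at [N]. *)
Lemma Hp_modulus_martingale N j x :
  F j x - martingale_of mu (partial_sum mu (2 ^ N) F) j x =
  if (j <= N)%N then 0 else F j x - F N x.
Proof.
rewrite /martingale_of partial_sum_pow2 martingale_cond_exp.
by case: leqP => _; rewrite ?subrr.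
Qed.

Lemma partial_sum_errorE N m j x : (2 ^ N <= m < 2 ^ N.+1)%N ->
  partial_sum_error mu m F j x = if (j <= N)%N then 0 else
    walsh_section mu (2 ^ N) m (diff N) x - (F j x - F N x).
Proof.
move=> mN; have /andP[m1 m2] := mN; have m3 := ltnW m2.
have mP := zeta_measurable_walsh_section mu (2 ^ N) (diff N) m3.
rewrite /partial_sum_error /martingale_of (partial_sum_block mN).
rewrite (cond_expD mu_haar)//; last exact: zeta_integrable mP.
rewrite martingale_cond_exp cond_exp_block//; case: leqP => _.
  by rewrite addr0 subrr.
by ring.
Qed.

End partial_sums.

(** * Error bound in H_p and convergence *)

Section Hp_estimates.
Context (R : realType) (mu : probability dyadic_group R) (mu_haar : haar mu).
Context (p : R) (p_gt0 : 0 < p) (p_lt1 : p < 1).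
Local Open Scope ereal_scope.

Lemma lee_poweRD (x y : \bar R) : 0 <= x -> 0 <= y ->
  (x + y) `^ p <= x `^ p + y `^ p.
Proof.
move: x y => [x| |] [y| |]// x0 y0; rewrite ?poweRyr ?gt_eqF ?addey ?addye ?leey//.
by rewrite -EFinD !poweR_EFin -EFinD lee_fin ler_powRD// ltW.
Qed.

Lemma lee_poweR (x y : \bar R) (r : R) : (0 <= r)%R -> 0 <= x -> x <= y ->
  x `^ r <= y `^ r.
Proof.
move=> r0 x0 xy; apply: gt0_ler_poweR => //.
  by rewrite in_itv /= x0 leey.
by rewrite in_itv /= leey (le_trans x0 xy).
Qed.

Lemma maximal_function_ge0 (G : nat -> dyadic_group -> R) x :
  0 <= maximal_function G x.
Proof.
apply: le_trans (ereal_sup_ubound _); last by exists 0%N.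
by rewrite lee_fin.
Qed.

Lemma maximal_function_ge (G : nat -> dyadic_group -> R) n x :
  `|G n x|%:E <= maximal_function G x.
Proof. by apply: ereal_sup_ubound; exists n. Qed.

Lemma measurable_maximal_function (G : nat -> dyadic_group -> R) :
  (forall n, measurable_fun [set: dyadic_group] (G n)) ->
  measurable_fun [set: dyadic_group] (maximal_function G).
Proof.
move=> mG; rewrite (_ : maximal_function G =
    fun x => esups (fun n => `|G n x|%:E) 0%N); last first.
  apply/funext => x; rewrite /maximal_function /esups; congr ereal_sup.
  by apply/seteqP; split=> _ [n _ <-]; exists n.
apply: (measurable_fun_esups (f := fun n x => `|G n x|%:E)) => n.
by apply/measurable_EFinP; exact: measurableT_comp.
Qed.

Lemma Hp_normE (G : nat -> dyadic_group -> R) :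
  Hp_norm mu p G = (\int[mu]_x maximal_function G x `^ p) `^ p^-1.
Proof.
rewrite /Hp_norm unlock; congr (_ `^ _); apply: eq_integral => x _.
by rewrite gee0_abs// maximal_function_ge0.
Qed.

Lemma supp_rateE m : (0 < m)%N ->
  supp_rate mu p m = ((m%:R / 2 ^+ logn 2 m) `^ (p^-1 - 1))%R.
Proof.
move=> m0; rewrite /supp_rate supp_dirichletE//; congr ((_ * _) `^ _)%R.
by rewrite [X in fine X](proj1 (haar_cyl mu) mu_haar).
Qed.

Lemma logn2_ratio_ge1 m : (0 < m)%N -> (1 <= m%:R / 2 ^+ logn 2 m :> R)%R.
Proof.
move=> m0; rewrite ler_pdivlMr ?exprn_gt0// mul1r -natrX ler_nat.
by apply: dvdn_leq => //; exact: pfactor_dvdnn.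
Qed.

Lemma supp_rate_gt0 m : (0 < m)%N -> (0 < supp_rate mu p m)%R.
Proof.
move=> m0; rewrite supp_rateE// powR_gt0//.
exact: lt_le_trans (logn2_ratio_ge1 m0).
Qed.

(** The quantitative form of (a). The maximal function of the error is at most |P| plus that of F -
    S_(2^N) F; on p-th powers this bound is additive, and [walsh_section_Lp] controls P by [d]. *)
Lemma Hp_norm_partial_sum_error F m : dyadic_martingale mu F -> (0 < m)%N ->
  Hp_norm mu p (partial_sum_error mu m F) <=
  ((block_constant p + 1) `^ p^-1 * supp_rate mu p m)%:E *
  Hp_modulus mu p (binary_order m) F.
Proof.
move=> mF m0; set N := binary_order m; have mN : (2 ^ N <= m < 2 ^ N.+1)%N.
  exact: binary_order_bounds.
have [m1 m2] := andP mN.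
have F_zeta (n : nat) : zeta_measurable n (F n) by case: mF.
have F_meas n : measurable_fun [set: dyadic_group] (F n).
  exact: zeta_measurable_measurable (@F_zeta n).
rewrite /Hp_modulus; set D := fun j x => _; set E := partial_sum_error mu m F.
pose d x := (F N.+1 x - F N x)%R.
pose P := walsh_section mu (2 ^ N) m d.
have md : zeta_measurable N.+1 d by exact: (zeta_measurable_diff mF).
have mP : zeta_measurable N.+1 P by apply: zeta_measurable_walsh_section; exact: ltnW.
have P_meas := zeta_measurable_measurable mP.
have d_meas := zeta_measurable_measurable md.
have DE j : D j = if (j <= N)%N then (fun=> 0%R) else (fun x => F j x - F N x)%R.
  by apply/funext => x; rewrite /D Hp_modulus_martingale//; case: leqP.
have EE j : E j = if (j <= N)%N then (fun=> 0%R) else (fun x => P x - (F j x - F N x))%R.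
  by apply/funext => x; rewrite /E (partial_sum_errorE mu_haar mF j x mN); case: leqP.
have mD : measurable_fun [set: dyadic_group] (maximal_function D).
  apply: measurable_maximal_function => n; rewrite DE.
  by case: leqP => _ //; exact: measurable_funB.
have mE : measurable_fun [set: dyadic_group] (maximal_function E).
  apply: measurable_maximal_function => n; rewrite EE.
  by case: leqP => _ //; apply: measurable_funB => //; exact: measurable_funB.
have maxE x : maximal_function E x <= `|P x|%:E + maximal_function D x.
  apply: ge_ereal_sup => _ [j _ <-]; rewrite EE.
  have := maximal_function_ge D j x; rewrite DE; case: leqP => jN.
    by rewrite !normr0 => h; rewrite adde_ge0.
  move=> h; apply: (@le_trans _ _ (`|P x|%:E + `|F j x - F N x|%:E)).
    by rewrite -EFinD lee_fin ler_normB.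
  exact: leeD.
(* [d] is the value of F - S_(2^N) F at time N + 1. *)
have maxd x : `|d x|%:E <= maximal_function D x.
  by apply: le_trans (maximal_function_ge D N.+1 x); rewrite DE ltnn.
have EP (f : dyadic_group -> R) n : zeta_measurable n f ->
    \int[mu]_x (`|f x|%:E `^ p) = (\int[mu]_x (`|f x| `^ p)%R)%:E.
  move=> mf; rewrite /Rintegral fineK.
    by apply: eq_integral => x _; rewrite poweR_EFin.
  apply: integrable_fin_num => //.
  apply: (@zeta_integrable _ _ n); exact: (zeta_measurable_op1 (fun u => `|u| `^ p)%R).
have mpow (f : dyadic_group -> \bar R) : measurable_fun [set: dyadic_group] f ->
    measurable_fun [set: dyadic_group] (fun x => f x `^ p).
  by move=> mf; apply: (measurableT_comp (measurable_poweR p)).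
have mabs (f : dyadic_group -> R) : measurable_fun [set: dyadic_group] f ->
    measurable_fun [set: dyadic_group] (fun x => `|f x|%:E).
  by move=> mf; apply/measurable_EFinP; exact: measurableT_comp.
set r := ((m%:R / 2 ^+ logn 2 m) `^ (1 - p))%R : R.
(* This lets the term that carries no rate be absorbed into a multiple of [r]. *)
have r1 : (1 <= r)%R.
  rewrite /r -[X in (X <= _)%R](powRr0 (m%:R / 2 ^+ logn 2 m)).
  by apply: ler_powR; rewrite ?logn2_ratio_ge1// subr_ge0 ltW.
have r0 := le_trans ler01 r1.
have C0 := block_constant_ge0 p_lt1.
have I0 : 0 <= \int[mu]_x (maximal_function D x `^ p).
  by apply: integral_ge0 => x _; exact: poweR_ge0.
have key : \int[mu]_x (maximal_function E x `^ p) <=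
    ((block_constant p + 1) * r)%:E * \int[mu]_x (maximal_function D x `^ p).
  apply: (@le_trans _ _ (\int[mu]_x (`|P x|%:E `^ p + maximal_function D x `^ p))).
    apply: ge0_le_integral => //.
    - by move=> x _; exact: poweR_ge0.
    - exact: mpow.
    - by apply: emeasurable_funD; apply: mpow => //; exact: mabs.
    move=> x _; apply: le_trans (lee_poweRD _ _); rewrite ?maximal_function_ge0//.
    by apply: lee_poweR; rewrite ?maximal_function_ge0 ?(ltW p_gt0).
  have mP1 := mpow _ (mabs _ P_meas); have mD1 := mpow _ mD.
  rewrite ge0_integralD//; try by move=> x _; exact: poweR_ge0.
  rewrite mulrDl mul1r EFinD ge0_muleDl ?lee_fin ?(mulr_ge0 C0 r0)//.
  apply: leeD; last first.
    by rewrite -[leLHS]mul1e lee_wpmul2r// lee_fin.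
  rewrite (EP P N.+1)//.
  apply: (@le_trans _ _ ((block_constant p * r)%:E * \int[mu]_x (`|d x|%:E `^ p))).
    by rewrite (EP d N.+1)// -EFinM lee_fin; exact: walsh_section_Lp.
  apply: lee_wpmul2l; first by rewrite lee_fin (mulr_ge0 C0 r0).
  apply: ge0_le_integral => //.
  - by move=> x _; exact: poweR_ge0.
  - exact: mpow (mabs _ d_meas).
  - by move=> x _; apply: lee_poweR; rewrite ?(ltW p_gt0).
rewrite !Hp_normE; apply: (le_trans (lee_poweR _ _ key)); first by rewrite invr_ge0 ltW.
  by apply: integral_ge0 => x _; exact: poweR_ge0.
rewrite poweRM ?lee_fin ?mulr_ge0 ?(addr_ge0 C0 ler01)// poweR_EFin.
rewrite lee_wpmul2r ?poweR_ge0// lee_fin powRM ?(addr_ge0 C0 ler01)//.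
(* The p-th root turns the exponent 1 - p into 1/p - 1, the one of [supp_rate]. *)
rewrite supp_rateE// /r -powRrM.
by rewrite mulrBl mul1r mulfV ?gt_eqF.
Qed.

Lemma cvge0_near (u : nat -> \bar R) : (forall k, 0 <= u k) ->
  (forall e : R, (0 < e)%R -> \forall k \near \oo, u k <= e%:E) ->
  u k @[k --> \oo] --> 0.
Proof.
move=> u0 ue; apply/fine_cvgP; split.
  apply: filterS (ue 1%R ltr01) => k uk.
  by rewrite ge0_fin_numE//; apply: (le_lt_trans uk); exact: ltry.
apply/cvgr0Pnorm_le => e e0; apply: filterS (ue _ e0) => k uk /=.
rewrite ger0_norm ?fine_ge0// -lee_fin fineK// ge0_fin_numE//.
by apply: (le_lt_trans uk); exact: ltry.
Qed.

Lemma Hp_convergence F (m : nat -> nat) : Hp mu p F -> (forall k, (0 < m k)%N) ->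
  ereal_littleo (fun k => Hp_modulus mu p (binary_order (m k)) F)
                (fun k => 1 / supp_rate mu p (m k))%R ->
  Hp_norm mu p (partial_sum_error mu (m k) F) @[k --> \oo] --> 0.
Proof.
move=> [mF _] m0 small; apply: cvge0_near => [k|e e0].
  by rewrite Hp_normE poweR_ge0.
set C := ((block_constant p + 1) `^ p^-1)%R.
have C0 : (0 < C)%R.
  by rewrite powR_gt0// ltr_wpDl// block_constant_ge0.
(* Dividing [e] by [C] offsets the constant of the error bound; the rate then cancels. *)
have := small (e / C)%R (divr_gt0 e0 C0); apply: filterS => k hk.
have s0 := supp_rate_gt0 (m0 k).
apply: (le_trans (Hp_norm_partial_sum_error mF (m0 k))); rewrite -/C.
have h : Hp_modulus mu p (binary_order (m k)) F <= (e / C / supp_rate mu p (m k))%:E.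
  apply: (le_trans (lee_abs _)); apply: (le_trans hk); rewrite lee_fin.
  by rewrite div1r ger0_norm ?invr_ge0 ?(ltW s0).
apply: (@le_trans _ _ ((C * supp_rate mu p (m k))%:E * (e / C / supp_rate mu p (m
  k))%:E)).
  by rewrite lee_wpmul2l// lee_fin mulr_ge0// ltW.
rewrite -EFinM lee_fin le_eqVlt; apply/orP; left; apply/eqP.
by field; rewrite !gt_eqF.
Qed.

End Hp_estimates.

(** * Lacunary martingales *)

Section lacunary_martingales.
Context (R : realType) (mu : probability dyadic_group R) (mu_haar : haar mu).
Context (p : R) (p_gt0 : 0 < p) (p_lt1 : p < 1).

(** This is b (D_(2^(N+1)) - D_(2^N)) in product form. *)
Definition walsh_atom (N : nat) (b : R) (x : dyadic_group) : R :=
  b * 2 ^+ N * (rademacher R N x * (x \in cyl N dzero)%:R).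

Lemma dflip_cyl N x : cyl N x (dflip N x).
Proof. by move=> k kN; rewrite /dflip /Defs.dadd (ltn_eqF kN). Qed.

Lemma zeta_measurable_atom N b : zeta_measurable N.+1 (walsh_atom N b).
Proof.
apply: (zeta_measurable_op1 ( *%R _)); apply: (zeta_measurable_op2 *%R).
  by apply/zeta_measurableP => x y xy; rewrite /rademacher xy.
exact: zeta_measurable_mem_cyl.
Qed.

Lemma walsh_atom_dflip N b x : walsh_atom N b (dflip N x) = - walsh_atom N b x.
Proof.
rewrite /walsh_atom -mulrN -mulNr; congr (_ * (_ * _)).
  by rewrite /rademacher /dflip /Defs.dadd eqxx signr_addb expr1 mulN1r.
have := @zeta_measurable_mem_cyl R _ _ dzero (leqnn N).
by move=> h; exact: (zeta_measurable_const h (@dflip_cyl N x)).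
Qed.

Lemma walsh_atom_out N b x : x \notin cyl N dzero -> walsh_atom N b x = 0.
Proof. by rewrite /walsh_atom => /negbTE ->; rewrite !mulr0. Qed.

Lemma normr_walsh_atom N b x : 0 <= b ->
  `|walsh_atom N b x| = b * 2 ^+ N * (x \in cyl N dzero)%:R.
Proof.
move=> b0; rewrite /walsh_atom /rademacher !normrM [X in _ * (X * _)]normrX normrN1
  expr1n mul1r.
by rewrite (ger0_norm b0) ger0_norm ?exprn_ge0// normr_nat.
Qed.

(** On I_N every w_k of this range reduces to r_N, and r_N squared is 1. *)
Lemma walsh_atom_coef N b k : (2 ^ N <= k < 2 ^ N.+1)%N ->
  \int[mu]_x (walsh_atom N b x * walsh R k x) = b.
Proof.
move=> kN; have /andP[_ k2] := kN.
have E x : walsh_atom N b x * walsh R k x = b * 2 ^+ N * (x \in cyl N dzero)%:R.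
  rewrite /walsh_atom -!mulrA; congr (_ * (_ * _)).
  have [xN|xN] := boolP (x \in cyl N dzero); last by rewrite !mul0r mulr0.
  rewrite mul1r (walsh_widen R x k2) big_ord_recr /= big1 => [|i _]; last first.
    by move/mem_cyl0 : xN => /(_ _ (ltn_ord i)) xi; rewrite /rademacher xi expr0 expr1n.
  rewrite (binary_digit_top kN) expr1 mul1r /rademacher -signr_addb addbb.
  by rewrite expr0.
under eq_Rintegral do rewrite E.
rewrite (Rintegral_cyl_mem mu N dzero (fun=> b * 2 ^+ N)).
rewrite (Rintegral_cyl mu_haar); last by apply/zeta_measurableP.
by rewrite mulfK// expf_neq0.
Qed.

Lemma walsh_atom_Lp N b : 0 <= b ->
  \int[mu]_x `|walsh_atom N b x| `^ p = (b * 2 ^+ N) `^ p / 2 ^+ N.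
Proof.
move=> b0; under eq_Rintegral => x _.
  rewrite normr_walsh_atom// powRM ?mulr_ge0 ?exprn_ge0//.
  have -> : (x \in cyl N dzero)%:R `^ p = (x \in cyl N dzero)%:R :> R.
    by case: (x \in _); rewrite ?powR1// powR0// gt_eqF.
  over.
rewrite (Rintegral_cyl_mem mu N dzero (fun=> (b * 2 ^+ N) `^ p)).
by rewrite (Rintegral_cyl mu_haar)//; apply/zeta_measurableP.
Qed.

Context (N : nat -> nat) (b : nat -> R).
Hypothesis N_incr : {homo N : i j / (i < j)%N}.
Hypothesis b_ge0 : forall k, 0 <= b k.

Local Notation atom k := (walsh_atom (N k) (b k)).

(** The atom of rank [k] enters at time [(N k).+1], when it is measurable; the bound [k < n] only
    makes the sum finite, since [k <= N k]. *)
Definition lacunary (n : nat) (x : dyadic_group) : R :=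
  \sum_(k < n | (N k < n)%N) atom k x.

Let N_ge k : (k <= N k)%N.
Proof.
by elim: k => // k IH; exact: leq_ltn_trans IH (N_incr (ltnSn k)).
Qed.

Let N_mono : {mono N : i j / (i <= j)%N}.
Proof. exact: leq_mono. Qed.

Lemma lacunary_widen n m x : (n <= m)%N ->
  lacunary n x = \sum_(k < m | (N k < n)%N) atom k x.
Proof.
move=> nm; rewrite /lacunary (big_ord_widen_cond m (fun k => (N k < n)%N) (fun k =>
  atom k x) nm).
apply: eq_bigl => k; apply: andb_idr => kn; exact: leq_ltn_trans kn.
Qed.

Lemma lacunaryB n m x : (n <= m)%N ->
  lacunary m x - lacunary n x = \sum_(k < m | (n <= N k < m)%N) atom k x.
Proof.
move=> nm; rewrite (lacunary_widen x nm) /lacunary.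
rewrite (bigID (fun k : 'I_m => (N k < n)%N)) /= addrAC.
have -> : \sum_(k < m | (N k < m)%N && (N k < n)%N) atom k x =
    \sum_(k < m | (N k < n)%N) atom k x.
  by apply: eq_bigl => k; apply: andb_idl => kn; exact: leq_trans nm.
by rewrite subrr add0r; apply: eq_bigl => k; rewrite -leqNgt andbC.
Qed.

Lemma zeta_measurable_lacunary n : zeta_measurable n (lacunary n).
Proof.
apply: zeta_measurable_sum => k kn.
exact: zeta_measurable_le kn (@zeta_measurable_atom _ _).
Qed.

(** An atom that enters after time [n] has [n <= N k] and is odd under the flip of coordinate [N k],
    so its integral over a cylinder of length [n] is 0. *)
Lemma lacunary_martingale : dyadic_martingale mu lacunary.
Proof.
split=> [n|n|n m nm]; first exact: zeta_measurable_lacunary.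
  exact: zeta_integrable (@zeta_measurable_lacunary n).
apply/funext => x; rewrite (cond_expE mu_haar); last first.
  exact: zeta_integrable (@zeta_measurable_lacunary m).
have mc := @measurable_cyl n x.
have intc g j : zeta_measurable j g -> mu.-integrable (cyl n x) (EFin \o g).
  by move=> /(zeta_integrable mu); exact: integrableS.
pose w k := if (n <= N k < m)%N then atom k else fun=> 0.
have mw k : zeta_measurable m (w k).
  rewrite /w; case: ifP => [/andP[_ km]|_]; last by apply/zeta_measurableP.
  exact: zeta_measurable_le km (@zeta_measurable_atom _ _).
rewrite (@eq_Rintegral _ _ _ _ _ (fun y => lacunary n y + \sum_(k < m) w k y));
  last first.
  move=> y _; rewrite -[LHS](subrK (lacunary n y)) lacunaryB// [LHS]addrC.
  congr (_ + _); rewrite big_mkcond /=.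
  by apply: eq_bigr => k _; rewrite /w; case: ifP.
rewrite RintegralD//; last 2 first.
- exact: intc (@zeta_measurable_lacunary n).
- by apply: (intc _ m); exact: zeta_measurable_sum.
rewrite (@Rintegral_sum _ _ _ _ _ _ m)// big1 ?addr0.
  rewrite (Rintegral_cyl mu_haar); last exact: zeta_measurable_lacunary.
  by rewrite mulrC divfK// expf_neq0.
move=> k _; rewrite /w; case: ifP => [/andP[nk _]|_].
  apply: (Rintegral_cyl_anti mu_haar (@zeta_measurable_atom _ _)) nk => y.
  exact: walsh_atom_dflip.
by rewrite Rintegral_cst// mul0r.
Qed.

Lemma lacunary_diff K x : lacunary (N K).+1 x - lacunary (N K) x = atom K x.
Proof.
rewrite lacunaryB//; have KN : (K < (N K).+1)%N by rewrite ltnS.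
rewrite (big_pred1 (Ordinal KN))// => k /=; rewrite ltnS -eqn_leq.
by rewrite eqn_leq !N_mono -eqn_leq eq_sym.
Qed.

(** The integral of |atom k|^p, by [walsh_atom_Lp]. *)
Let decay k : R := (b k * 2 ^+ N k) `^ p / 2 ^+ N k.

Let decay_ge0 k : 0 <= decay k.
Proof. by rewrite divr_ge0 ?powR_ge0 ?exprn_ge0. Qed.

Hypothesis decay_half : forall k, 2 * decay k.+1 <= decay k.

(** The remainder [2 * decay n] pays for both the next term and the next remainder. *)
Let sum_decay K n : (K <= n)%N ->
  \sum_(K <= k < n) decay k + 2 * decay n <= 2 * decay K.
Proof.
move=> Kn; rewrite -(subnKC Kn); elim: (n - K)%N => [|i IH].
  by rewrite addn0 big_geq// add0r.
rewrite addnS big_nat_recr ?leq_addr//=; have := decay_half (K + i).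
lra.
Qed.

Local Open Scope ereal_scope.

(** Serves both for the martingale ([K = 0]) and for its modulus of continuity. By subadditivity,
    the p-th power of the maximal function is at most the series of the |atom k|^p, which is
    integrated term by term. *)
Lemma lacunary_Hp_bound K (G : nat -> dyadic_group -> R) :
  (forall j, measurable_fun [set: dyadic_group] (G j)) ->
  (forall j x, `|G j x| <= \sum_(K <= k < j) `|atom k x|)%R ->
  Hp_norm mu p G <= ((2 * decay K) `^ p^-1)%:E.
Proof.
move=> mG hG; rewrite Hp_normE -poweR_EFin; apply: lee_poweR.
- by rewrite invr_ge0 ltW.
- by apply: integral_ge0 => x _; exact: poweR_ge0.
pose S x := \sum_(0 <= k <oo) (if (K <= k)%N then (`|atom k x| `^ p)%:E else 0).
have pos k x : 0 <= if (K <= k)%N then (`|atom k x| `^ p)%:E else 0.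
  by case: ifP => // _; rewrite lee_fin powR_ge0.
have mpk k : zeta_measurable (N k).+1 (fun x => (`|atom k x| `^ p)%R).
  exact: (zeta_measurable_op1 (fun u => `|u| `^ p)%R (@zeta_measurable_atom _ _)).
have mpos k : measurable_fun [set: dyadic_group]
    (fun x => if (K <= k)%N then (`|atom k x| `^ p)%:E else 0).
  case: (K <= k)%N => //; apply/measurable_EFinP.
  exact: zeta_measurable_measurable (mpk k).
have mS : measurable_fun [set: dyadic_group] S.
  by apply: ge0_emeasurable_sum.
have S0 x : 0 <= S x by apply: nneseries_ge0 => k _ _; exact: pos.
have GS j x : (`|G j x| `^ p)%:E <= S x.
  apply: (@le_trans _ _ (\sum_(0 <= k < j) (if (K <= k)%N then (`|atom k x| `^ p)%:E
    else 0))); last first.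
    by apply: nneseries_lim_ge => k _ _; exact: pos.
  rewrite (eq_bigr (fun k => (if (K <= k)%N then `|atom k x| `^ p else 0)%R%:E));
    last by move=> k _; case: ifP.
  rewrite sumEFin lee_fin.
  have -> : (\sum_(0 <= k < j) (if (K <= k)%N then `|atom k x| `^ p else 0) =
     \sum_(K <= k < j) `|atom k x| `^ p)%R.
    rewrite -big_mkcond /=; have [Kj|jK] := leqP K j; last first.
      rewrite [RHS]big_geq ?(ltnW jK)// big_nat_cond big1// => k /andP[/andP[_ kj]].
      by rewrite leqNgt (ltn_trans kj jK).
    rewrite (big_cat_nat (leq0n K) Kj) /= big_nat_cond big1 ?add0r.
      by rewrite big_nat_cond [RHS]big_nat_cond; apply: eq_bigl => k; case: (K <= k)%N.
    by move=> k /andP[/andP[_ kK]]; rewrite leqNgt kK.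
  apply: le_trans (ler_powR_sum p_gt0 (ltW p_lt1) _ _) => //.
  by apply: ge0_ler_powR; rewrite ?nnegrE ?(ltW p_gt0)// sumr_ge0.
have maxS x : maximal_function G x `^ p <= S x.
  have -> : S x = (S x `^ p^-1) `^ p.
    by rewrite -poweRrM mulVf ?gt_eqF// poweRe1.
  apply: lee_poweR; rewrite ?(ltW p_gt0) ?maximal_function_ge0//.
  apply: ge_ereal_sup => _ [j _ <-].
  have -> : `|G j x|%:E = ((`|G j x| `^ p)%:E `^ p^-1).
    by rewrite poweR_EFin -powRrM mulfV ?gt_eqF// powRr1.
  by apply: lee_poweR; rewrite ?invr_ge0 ?(ltW p_gt0) ?lee_fin ?powR_ge0.
apply: (@le_trans _ _ (\int[mu]_x S x)).
  apply: ge0_le_integral => //; first by move=> x _; exact: poweR_ge0.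
  exact: measurableT_comp (measurable_poweR p) (measurable_maximal_function mG).
rewrite integral_nneseries//.
apply: lime_le; first by apply: is_cvg_nneseries => k _ _; exact: integral_ge0.
near=> n.
have intk k : \int[mu]_x (if (K <= k)%N then (`|atom k x| `^ p)%:E else 0) =
    (if (K <= k)%N then decay k else 0%R)%:E.
  case: ifP => _; last by rewrite integral0.
  rewrite /decay -walsh_atom_Lp// /Rintegral fineK//.
  apply: integrable_fin_num => //; exact: zeta_integrable (mpk k).
under eq_bigr do rewrite intk.
rewrite sumEFin lee_fin -big_mkcond /=.
have Kn : (K <= n)%N by near: n; exists K.
rewrite (big_cat_nat (leq0n K) Kn) /= big_nat_cond big1 ?add0r; last first.
  by move=> k /andP[/andP[_ kK]]; rewrite leqNgt kK.
apply: le_trans (sum_decay Kn).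
rewrite big_nat_cond [X in (_ <= X + _)%R]big_nat_cond.
rewrite [X in (X <= _)%R](eq_bigl (fun k => (K <= k < n)%N && true)); last by move=> k;
  case: (K <= k)%N; rewrite ?andbT.
by rewrite lerDl mulr_ge0.
Unshelve. all: by end_near. Qed.

Local Close Scope ereal_scope.

Lemma normr_lacunaryB K j x : (N K <= j)%N ->
  `|lacunary j x - lacunary (N K) x| <= \sum_(K <= k < j) `|atom k x|.
Proof.
move=> Kj; rewrite lacunaryB//; apply: (le_trans (ler_norm_sum _ _ _)).
rewrite -(big_mkord (fun k => (N K <= N k < j)%N) (fun k => `|atom k x|)).
have KJ := leq_trans (N_ge K) Kj.
rewrite (big_cat_nat (leq0n K) KJ) /= big_nat_cond big1 ?add0r; last first.
  by move=> k /andP[/andP[_ kK]]; rewrite N_mono leqNgt kK.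
by rewrite [leRHS](bigID (fun k => (N K <= N k < j)%N)) /= lerDl sumr_ge0.
Qed.

Lemma lacunary_Hp : Hp mu p lacunary.
Proof.
split; first exact: lacunary_martingale.
apply: (@le_lt_trans _ _ ((2 * decay 0) `^ p^-1)%:E); last exact: ltry.
apply: lacunary_Hp_bound => [j|j x].
  exact: zeta_measurable_measurable (@zeta_measurable_lacunary j).
apply: (le_trans (ler_norm_sum _ _ _)).
rewrite big_mkord [leRHS](bigID (fun k : 'I_j => (N k < j)%N)) /= lerDl.
by rewrite sumr_ge0.
Qed.

Lemma lacunary_modulus K :
  (Hp_modulus mu p (N K) lacunary <= ((2 * decay K) `^ p^-1)%:E)%E.
Proof.
apply: lacunary_Hp_bound => [j|j x].
  rewrite (_ : (fun _ => _) = fun x =>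
    if (j <= N K)%N then 0 else lacunary j x - lacunary (N K) x); last first.
    by apply/funext => x; rewrite (Hp_modulus_martingale mu_haar lacunary_martingale).
  case: (j <= N K)%N => //.
  by apply: measurable_funB;
    apply: zeta_measurable_measurable (@zeta_measurable_lacunary _).
rewrite (Hp_modulus_martingale mu_haar lacunary_martingale).
case: leqP => jK; first by rewrite normr0 sumr_ge0.
exact: normr_lacunaryB (ltnW jK).
Qed.

(** * Partial sum errors of a lacunary martingale *)

Section error.
Variables (K m : nat).
Hypothesis mK : (2 ^ N K <= m < 2 ^ (N K).+1)%N.
Hypothesis lN : (logn 2 m < N K)%N.

Let m_gt0 : (0 < m)%N.
Proof. by case/andP: mK => + _; apply: leq_trans; rewrite expn_gt0. Qed.

Local Notation l := (logn 2 m).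
Local Notation err := (partial_sum_error mu m lacunary).

(** The difference at time [N K] is the atom of rank [K], whose coefficients in the block all equal
    [b K]; the section is thus a difference of Dirichlet kernels. *)
Lemma lacunary_errorE j x : err j x = if (j <= N K)%N then 0 else
  b K * (dirichlet R m x - dirichlet R (2 ^ N K) x) -
  \sum_(k < j | (N K <= N k < j)%N) atom k x.
Proof.
rewrite (partial_sum_errorE mu_haar lacunary_martingale j x mK).
case: leqP => // Kj; rewrite (lacunaryB x (ltnW Kj)); congr (_ - _).
rewrite -sum_walsh_range; last by case/andP: mK.
rewrite /walsh_section mulr_sumr !big_nat; apply: eq_bigr => k /andP[k1 k2].
congr (_ * _); under eq_Rintegral do rewrite lacunary_diff.
by apply: walsh_atom_coef; rewrite k1 (ltn_trans k2)//; case/andP: mK.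
Qed.

(** As x lies outside I_(l+1) and [l < N K], the kernel D_(2^(N K)) and the atoms of rank at least
    [K] vanish at x: the error is constant beyond time [N K]. *)
Lemma lacunary_error_limit (x : dyadic_group) : x \in cyl l dzero -> x l ->
  `|limit_function err x| = b K * 2 ^+ l.
Proof.
move=> xl xl1.
have out n : (l < n)%N -> x \notin cyl n dzero.
  by move=> ln; apply/negP => /mem_cyl0 /(_ _ ln); rewrite xl1.
have -> : limit_function err x = b K * dirichlet R m x.
  apply: norm_lim_near_cst; exists (N K).+1 => // j /= Kj.
  rewrite lacunary_errorE leqNgt Kj/= dirichlet_pow2 (negbTE (out _ lN)) mulr0 subr0.
  rewrite big1 ?subr0// => k /andP[Kk _]; apply: walsh_atom_out; apply: out.
  exact: leq_trans Kk.
by rewrite normrM normr_dirichlet// ger0_norm.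
Qed.

(** If x_s = 1, the atoms with [s < N k] vanish near x; the other atoms and the kernels are constant
    on cylinders of a suitable length. *)
Lemma lacunary_error_locally_constant (x : dyadic_group) s : x s -> exists n, forall y,
  cyl n x y -> limit_function err y = limit_function err x.
Proof.
move=> xs; exists (maxn s (N K)).+1 => y xy; rewrite /limit_function.
suff -> : err ^~ y = err ^~ x by [].
have out z n : cyl (maxn s (N K)).+1 x z -> (s < n)%N -> z \notin cyl n dzero.
  move=> xz sn; apply/negP => /mem_cyl0 /(_ _ sn).
  by rewrite xz ?xs// ltnS leq_maxl.
apply/funext => j; rewrite !lacunary_errorE; case: leqP => // Kj.
congr (_ * _ - _).
  have mD k : (k <= m)%N -> zeta_measurable (maxn s (N K)).+1 (dirichlet R k).
    move=> km; apply: zeta_measurable_sum => i _; apply: zeta_measurable_walsh.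
    apply: (leq_trans (ltn_ord i)); apply: (leq_trans km).
    case/andP : mK => _ /ltnW /leq_trans; apply.
    by rewrite leq_exp2l// ltnS leq_maxr.
  rewrite (zeta_measurable_const (mD _ (leqnn m)) xy).
  by rewrite (zeta_measurable_const (mD _ _) xy)//; case/andP: mK.
apply: eq_bigr => k _; have [kn|nk] := leqP (N k).+1 (maxn s (N K)).+1.
  by apply: (zeta_measurable_const _ xy);
    exact: zeta_measurable_le kn (@zeta_measurable_atom _ _).
have sk : (s < N k)%N by rewrite ltnS in nk; apply: leq_trans nk; rewrite ltnS leq_maxl.
by rewrite !walsh_atom_out//; apply: out.
Qed.

(** Away from [dzero] the set is a countable union of cylinders; [dzero], where [lim] may be a
    default value, is split off as a measurable singleton. *)
Lemma measurable_lacunary_error_gt c :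
  measurable [set x | c < `|limit_function err x|].
Proof.
set T := [set x | _].
have -> : T = (T `&` [set dzero]) `|`
    \bigcup_(s : seq bool) (if `[< cyl (size s) (nth false s) `<=` T >]
                            then cyl (size s) (nth false s) else set0).
  apply/seteqP; split=> [x Tx|x [[]//|[s _]]]; last by case: asboolP => // sT /sT.
  have [x0|x0] := pselect (x = dzero); first by left.
  right; have [s xs] : exists s, x s.
    apply: contrapT => /forallNP h; apply: x0; apply/funext => k.
    by apply/negbTE/negP; exact: h.
  have [n hn] := lacunary_error_locally_constant xs.
  exists (mkseq x n) => //.
  have e : cyl (size (mkseq x n)) (nth false (mkseq x n)) = cyl n x.
    by rewrite size_mkseq; apply: cyl_eq => k kn; rewrite nth_mkseq.
  rewrite e; case: asboolP => // -[]; move=> y /hn; by rewrite /T /= => ->.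
apply: measurableU; last first.
  apply: countable_bigcupT_measurable => // s.
  by case: asboolP => _; [exact: measurable_cyl|exact: measurable0].
have m0 : measurable [set dzero].
  rewrite (_ : [set dzero] = \bigcap_n cyl n dzero).
    by apply: bigcapT_measurable => n; exact: measurable_cyl.
  apply/seteqP; split=> [x -> n _|x h]; first exact: cyl_refl.
  by apply/funext => k; exact: (h k.+1).
have [T0|T0] := pselect (T dzero).
  by rewrite (_ : T `&` _ = [set dzero])//; apply: setIidr => x ->.
by rewrite (_ : T `&` _ = set0)// -subset0 => x [Tx /= xd]; apply: T0; rewrite -xd.
Qed.

Lemma lacunary_error_weak_norm : b K = (2 ^+ l) `^ (p^-1 - 1) ->
  (((2^-1 `^ p / 2) `^ p^-1)%:E <= weak_Lp_norm mu p (limit_function err))%E.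
Proof.
move=> bE; rewrite /weak_Lp_norm -poweR_EFin.
have c0 : 0 < 2 ^+ l :> R by rewrite exprn_gt0.
have pV : 0 <= p^-1 by rewrite invr_ge0 ltW.
apply: lee_poweR => //.
(* Half the value 2^(l/p) that the error takes on I_l minus I_(l+1), so that the inequality is
   strict there. *)
pose s := 2^-1 * (2 ^+ l) `^ p^-1 : R.
have bl : b K * 2 ^+ l = (2 ^+ l) `^ p^-1.
  by rewrite bE -[X in _ * X](powRr1 (ltW c0)) -powRD ?subrK// (gt_eqF c0) implybT.
have s0 : 0 < s by rewrite mulr_gt0 ?powR_gt0.
apply: (@le_trans _ _ ((s `^ p)%:E * mu [set x | s < `|limit_function err x|]%R)%E);
  last first.
  by apply: ereal_sup_ubound; exists s.
(* The cylinder of length l + 1 at [e] is I_l minus I_(l+1). *)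
pose e : dyadic_group := fun k => k == l.
have sub : cyl l.+1 e `<=` [set x | s < `|limit_function err x|].
  move=> x xe /=; rewrite lacunary_error_limit.
  - by rewrite bl /s gtr_pMl ?powR_gt0// invf_lt1 ?ltr1n.
  - by apply/mem_cyl0 => k kl; rewrite xe ?ltnS ?(ltnW kl)// /e (ltn_eqF kl).
  - by rewrite xe// /e eqxx.
have le_mu : (((2 ^+ l.+1)^-1)%:E <= mu [set x | s < `|limit_function err x|]%R)%E.
  rewrite -((haar_cyl mu).1 mu_haar l.+1 e); apply: le_measure => //; rewrite inE.
  - exact: measurable_cyl.
  - exact: measurable_lacunary_error_gt.
apply: (@le_trans _ _ ((s `^ p)%:E * ((2 ^+ l.+1)^-1)%:E)%E); last first.
  by apply: lee_wpmul2l => //; rewrite lee_fin powR_ge0.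
rewrite -EFinM lee_fin /s powRM ?powR_ge0// -powRrM mulVf ?gt_eqF// powRr1 ?(ltW c0)//.
rewrite exprS invfM le_eqVlt; apply/orP; left; apply/eqP.
by field; rewrite gt_eqF.
Qed.

End error.

End lacunary_martingales.

(** * Divergence *)

(** Since m / 2^l < 2^(N - l + 1), a bound on N - l beyond some index would bound all the values. *)
Lemma unbounded_order_gap (R : realType) (mu : probability dyadic_group R)
    (m : nat -> nat) : haar mu -> (forall k, (0 < m k)%N) ->
  ereal_sup (range (fun k =>
    ((m k)%:R * fine (mu (supp_dirichlet R (m k))))%:E)) = +oo%E ->
  forall j M : nat, exists i, (j < i)%N /\
    (logn 2 (m i) + M <= binary_order (m i))%N.
Proof.
move=> mu_haar m0 sup_oo j M; apply: contrapT => /forallNP none.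
pose val k : R := (m k)%:R * fine (mu (supp_dirichlet R (m k))).
have valE k : val k = (m k)%:R / 2 ^+ logn 2 (m k).
  rewrite /val supp_dirichletE//; congr (_ * _).
  by rewrite [X in fine X]((haar_cyl mu).1 mu_haar).
have val0 k : 0 <= val k by rewrite valE divr_ge0 ?exprn_ge0.
(* The finite sum accounts for the indices up to [j], and 2^M for the later ones. *)
suff : (ereal_sup (range (fun k => (val k)%:E)) <=
    (2 ^+ M + \sum_(k < j.+1) val k)%:E)%E by rewrite sup_oo leye_eq.
apply: ge_ereal_sup => _ [i _ <-]; rewrite lee_fin.
have [ij|ji] := leqP i j.
  have ij' : (i < j.+1)%N by rewrite ltnS.
  rewrite (bigD1 (Ordinal ij'))//= addrCA lerDl addr_ge0 ?exprn_ge0//.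
  exact: sumr_ge0.
apply: ler_wpDr; first exact: sumr_ge0.
have lt : (binary_order (m i) < logn 2 (m i) + M)%N.
  by rewrite ltnNge; apply/negP => h; exact: (none i).
rewrite valE ler_pdivrMr ?exprn_gt0// -exprD addnC -natrX ler_nat.
have /andP[_ /ltnW h] := binary_order_bounds (m0 i).
by apply: (leq_trans h); rewrite leq_exp2l.
Qed.

Section divergence.
Context (R : realType) (mu : probability dyadic_group R) (mu_haar : haar mu).
Context (p : R) (p_gt0 : 0 < p) (p_lt1 : p < 1).

Lemma powR_rate (a : R) : 0 <= a -> (a `^ (p^-1 - 1)) `^ p = a `^ (1 - p).
Proof. by move=> a0; rewrite -powRrM mulrBl mul1r mulVf ?gt_eqF. Qed.

Lemma Hp_divergence (m : nat -> nat) : (forall k, (0 < m k)%N) ->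
  ereal_sup (range (fun k =>
    ((m k)%:R * fine (mu (supp_dirichlet R (m k))))%:E)) = +oo%E ->
  exists (F : nat -> dyadic_group -> R) (phi : nat -> nat),
    [/\ Hp mu p F, {homo phi : i j / (i < j)%N},
        ereal_bigO (fun k => Hp_modulus mu p (binary_order (m (phi k))) F)
                   (fun k => 1 / supp_rate mu p (m (phi k))) &
        forall k, (((2^-1 `^ p / 2) `^ p^-1)%:E <= weak_Lp_norm mu p
          (limit_function (partial_sum_error mu (m (phi k)) F)))%E].
Proof.
move=> m0 sup_oo; have gap := unbounded_order_gap mu_haar m0 sup_oo.
have p1 : 0 < 1 - p by rewrite subr_gt0.
have pV : 0 < p^-1 by rewrite invr_gt0.
(* Chosen so that 2^(A (1 - p)) is at least 2: increasing N - l by [A] halves the decay. *)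
pose A := (Num.truncn (1 - p)^-1).+1.
have A_large : 1 <= A%:R * (1 - p).
  by rewrite -ler_pdivrMr// mul1r ltW// truncnS_gt.
(* Asking for a gap beyond the previous order plus [A] makes both N_k and N_k - l_k grow by at least
   [A]. *)
have /choice[next nextP] : forall j, exists i, (j < i)%N /\
    (logn 2 (m i) + (binary_order (m j) + A) <= binary_order (m i))%N.
  by move=> j; exact: gap.
(* One iteration is made already at [k = 0], so that l_0 < N_0 holds too. *)
pose phi k := iter k.+1 next 0%N.
pose N k := binary_order (m (phi k)); pose l k := logn 2 (m (phi k)).
pose b k : R := (2 ^+ l k) `^ (p^-1 - 1).
have phi_incr : {homo phi : i j / (i < j)%N}.
  by apply: homo_ltn => [|i]; [exact: ltn_trans|exact: (nextP _).1].
have gapN k : (l k.+1 + (N k + A) <= N k.+1)%N by exact: (nextP (phi k)).2.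
have lN k : (l k < N k)%N.
  have := (nextP (iter k next 0%N)).2; rewrite -/(phi k) -/(l k) -/(N k) /A.
  by move: (binary_order _) => n; lia.
have N_incr : {homo N : i j / (i < j)%N}.
  by apply: homo_ltn => [|i]; [exact: ltn_trans|have := gapN i; rewrite /A; lia].
have b0 k : 0 <= b k by exact: powR_ge0.
have ratio_ge0 k : 0 <= 2 ^+ l k / 2 ^+ N k :> R by rewrite divr_ge0 ?exprn_ge0.
have decayE k : (b k * 2 ^+ N k) `^ p / 2 ^+ N k = (2 ^+ l k / 2 ^+ N k) `^ (1 - p).
  have c0 : 0 < 2 ^+ N k :> R by rewrite exprn_gt0.
  rewrite !powRM ?invr_ge0 ?exprn_ge0// powR_rate ?exprn_ge0// -mulrA.
  congr (_ * _); rewrite powRV ?(ltW c0)// -powRN opprB powRB ?powRr1 ?(ltW c0)//.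
  by rewrite (gt_eqF c0) implybT.
have decay k : 2 * ((b k.+1 * 2 ^+ N k.+1) `^ p / 2 ^+ N k.+1) <=
    (b k * 2 ^+ N k) `^ p / 2 ^+ N k.
  rewrite !decayE; apply: (@le_trans _ _ ((2 ^+ A) `^ (1 - p) *
      (2 ^+ l k.+1 / 2 ^+ N k.+1) `^ (1 - p))).
    rewrite ler_wpM2r ?powR_ge0// -powR_mulrn// -powRrM.
    by rewrite -[X in X <= _]powRr1//; apply: ler_powR; rewrite ?ler1n.
  rewrite -powRM ?exprn_ge0//; apply: ge0_ler_powR; rewrite ?nnegrE ?(ltW p1)//.
  rewrite mulrA -exprD ler_pdivrMr ?exprn_gt0// mulrAC ler_pdivlMr ?exprn_gt0//.
  rewrite -!exprD -!natrX ler_nat leq_exp2l//.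
  by have := gapN k; lia.
have bounds k : (2 ^ N k <= m (phi k) < 2 ^ (N k).+1)%N by exact: binary_order_bounds.
exists (lacunary N b), phi; split=> //.
- exact: lacunary_Hp decay.
(* One factor 2 comes from the tail of the series, the other bounds the 2^(1 - p) lost when m <
   2^(N+1) replaces 2^N by m. *)
- exists (4 `^ p^-1); exists 0%N => // k _.
  have h := lacunary_modulus mu_haar p_gt0 p_lt1 N_incr b0 decay k.
  rewrite gee0_abs; last by rewrite /Hp_modulus Hp_normE poweR_ge0.
  apply: (le_trans h); rewrite lee_fin decayE.
  have s0 := supp_rate_gt0 mu_haar p (m0 (phi k)).
  rewrite div1r ger0_norm ?invr_ge0 ?(ltW s0)// supp_rateE// -/(l k).
  have q0 : 0 <= (m (phi k))%:R / 2 ^+ l k :> R by rewrite divr_ge0 ?exprn_ge0.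
  rewrite -powRV// invf_div.
  have -> : (2 ^+ l k / (m (phi k))%:R) `^ (p^-1 - 1) =
      ((2 ^+ l k / (m (phi k))%:R) `^ (1 - p)) `^ p^-1.
    by rewrite -powRrM mulrBl mul1r mulfV ?gt_eqF.
  set t := 2 ^+ l k / (m (phi k))%:R;
    apply: (@le_trans _ _ ((4 * t `^ (1 - p)) `^ p^-1)); last first.
    by rewrite (powRM p^-1 (ler0n R 4) (powR_ge0 t (1 - p))) lexx.
  apply: ge0_ler_powR; rewrite ?nnegrE ?(ltW pV) ?mulr_ge0 ?powR_ge0//.
  have -> : 4 = 2 * 2 :> R by ring.
  rewrite -mulrA ler_wpM2l//.
  apply: (@le_trans _ _ (2 `^ (1 - p) * (2 ^+ l k / (m (phi k))%:R) `^ (1 - p))).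
    rewrite -powRM ?divr_ge0 ?exprn_ge0//.
    apply: ge0_ler_powR; rewrite ?nnegrE ?(ltW p1) ?mulr_ge0 ?divr_ge0 ?exprn_ge0//.
    have mk : 0 < (m (phi k))%:R :> R by rewrite ltr0n.
    rewrite mulrCA ler_wpM2l ?exprn_ge0// ler_pdivlMr// mulrC.
    rewrite ler_pdivrMr ?exprn_gt0// -exprS -natrX ler_nat ltnW//.
    by case/andP: (bounds k).
  rewrite ler_wpM2r ?powR_ge0// -[leRHS]powRr1//; apply: ler_powR; rewrite ?ler1n//.
  by rewrite gerBl ltW.
- by move=> k; exact: (lacunary_error_weak_norm mu_haar p_gt0 N_incr b0 (bounds k)
  (lN k)).
Qed.

End divergence.

Theorem corollary4 (R : realType) (mu : probability dyadic_group R)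
    (mu_haar : haar mu) (p : R) (p_gt0 : 0 < p) (p_lt1 : p < 1) :
  (forall (F : nat -> dyadic_group -> R) (m : nat -> nat),
      Hp mu p F ->
      (forall k, (0 < m k)%N) ->
      ereal_littleo (fun k => Hp_modulus mu p (binary_order (m k)) F)
                    (fun k => 1 / supp_rate mu p (m k)) ->
      Hp_norm mu p (partial_sum_error mu (m k) F) @[k --> \oo] --> 0%E)
  /\
  (exists2 c : R, 0 < c &
    forall m : nat -> nat,
      (forall k, (0 < m k)%N) ->
      {homo m : i j / (i < j)%N} ->
      ereal_sup (range (fun k =>
        ((m k)%:R * fine (mu (supp_dirichlet R (m k))))%:E)) = +oo%E ->
      exists (F : nat -> dyadic_group -> R) (alpha : nat -> nat),
        [/\ Hp mu p F,
            exists2 phi : nat -> nat, {homo phi : i j / (i < j)%N} &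
              forall k, alpha k = m (phi k),
            ereal_bigO (fun k => Hp_modulus mu p (binary_order (alpha k)) F)
                       (fun k => 1 / supp_rate mu p (alpha k)) &
            (c%:E < limn_esup (fun k =>
               weak_Lp_norm mu p
                 (limit_function (partial_sum_error mu (alpha k) F))))%E]).
Proof.
split; first by move=> F m; exact: Hp_convergence.
set c := (2^-1 `^ p / 2) `^ p^-1.
have c0 : 0 < c by rewrite powR_gt0// divr_gt0// powR_gt0.
(* Halving gives the strict inequality, each weak norm being only known to be at least [c]. *)
exists (c / 2); first by rewrite divr_gt0.
move=> m m0 _ /(Hp_divergence mu_haar p_gt0 p_lt1 m0)[F [phi [HF phi_incr O weak]]].
exists F, (fun k => m (phi k)); split=> //; first by exists phi.
apply: (@lt_le_trans _ _ c%:E); first by rewrite lte_fin; lra.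
rewrite limn_esup_lim; apply: lime_ge; first exact: is_cvg_esups.
apply: nearW => k; apply: (le_trans (weak k)).
by apply: ereal_sup_ubound; exists k => /=.
Qed.
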